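(* Let $(\Omega,\Sigma,\mathbb{P})$ be a nonatomic probability space, let $\mathcal{K}$ be a convex bounded subset of $\mathbb{L}^1(\mathbb{P})$, and let $\overline{\mathcal{K}}$ be its closure in $\mathbb{L}^0(\mathbb{P})$ with respect to the $\mathbb{L}^0(\mathbb{P})$-topology. The following are equivalent. (1) The relative $\mathbb{L}^0(\mathbb{P})$-topology on $\overline{\mathcal{K}}$ is uniformly locally convex-solid on $\overline{\mathcal{K}}$. (2) There exists a probability measure $\mathbb{Q}\sim\mathbb{P}$ such that $\mathcal{K}$ is $\mathbb{Q}$-uniformly integrable.
   Context: $\mathbb{L}^0(\mathbb{P})$ is the space of all real random variables on $(\Omega,\Sigma)$ modulo a.s. equality; the $\mathbb{L}^0(\mathbb{P})$-topology is the topology of convergence in probability. Bounded in $\mathbb{L}^1(\mathbb{P})$ means $\sup_{X\in\mathcal{K}}\mathbb{E}_{\mathbb{P}}[|X|]<\infty$. $\mathbb{Q}\sim\mathbb{P}$ means that $\mathbb{Q}$ is a probability measure on $(\Omega,\Sigma)$ mutually absolutely continuous with $\mathbb{P}$. A set $\mathcal{W}\subseteq\mathbb{L}^0(\mathbb{P})$ is solid if $Y\in\mathcal{W}$ whenever there is $X\in\mathcal{W}$ with $|Y|\le|X|$; it is convex-solid if it is convex and solid. For a convex bounded set $\mathcal{A}$ in $\mathbb{L}^1(\mathbb{P})$ and a nonempty subset $\mathcal{S}\subseteq\mathcal{A}$, the $\mathbb{L}^0(\mathbb{P})$-topology on $\mathcal{A}$ is uniformly locally convex-solid on $\mathcal{S}$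 if for every $\mathbb{L}^0(\mathbb{P})$-neighborhood $\mathcal{U}$ of $0$ there exists a convex-solid set $\mathcal{W}\subseteq\mathcal{U}$ such that, for every $X\in\mathcal{S}$, $(X+\mathcal{W})\cap\mathcal{A}$ is a neighborhood of $X$ in the relative $\mathbb{L}^0(\mathbb{P})$-topology on $\mathcal{A}$. *)

(* Defs.v *)
From HB Require Import structures.
From mathcomp Require Import all_boot all_order all_algebra.
From mathcomp Require Import all_classical all_reals all_analysis.
From mathcomp Require Import measurable_realfun.

Set Implicit Arguments.
Unset Strict Implicit.
Unset Printing Implicit Defensive.

Import Order.TTheory GRing.Theory Num.Theory.
Import numFieldNormedType.Exports.

Local Open Scope classical_set_scope.
Local Open Scope ring_scope.
Local Open Scope quotient_scope.

(* The quotient of measurable functions by P-a.s. equality is the library's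
   type {mfun_ P, T >-> R}; the alias L0 P carries its real vector space
   structure and the topology of convergence in probability. *)
Definition L0 {d : measure_display} {T : measurableType d} {R : realType}
  (P : probability T R) : Type := {mfun_ P, T >-> R}.

HB.instance Definition _ d (T : measurableType d) (R : realType)
  (P : probability T R) := Choice.copy (L0 P) {mfun_ P, T >-> R}.

Definition L0_fun {d : measure_display} {T : measurableType d} {R : realType}
  (P : probability T R) (X : L0 P) : {mfun T >-> R} := repr X.
Coercion L0_fun : L0 >-> MeasurableFun.type.

Section L0_vector_space.
Context {d : measure_display} {T : measurableType d} {R : realType}.
Variable P : probability T R.
Implicit Types (X Y Z : L0 P) (f g : {mfun T >-> R}).

Definition L0_class (f : {mfun T >-> R}) : L0 P := \pi_({mfun_ P, T >-> R}) f.

Lemma L0_classP f g : L0_class f = L0_class g <-> {ae P, forall w, f w = g w}.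
Proof.
split=> [/eqP|fg].
  by rewrite eqmodE => /asboolP; apply: filterS => w; apply.
by apply/eqP; rewrite eqmodE; apply/asboolP; apply: filterS fg => w.
Qed.

Lemma L0_funK X : L0_class X = X.
Proof. exact: reprK. Qed.

Lemma L0_classK f : {ae P, forall w, L0_class f w = f w}.
Proof. by apply/L0_classP; rewrite L0_funK. Qed.

Definition L0_zero : L0 P := L0_class (0 : {mfun T >-> R}).
Definition L0_add (X Y : L0 P) : L0 P :=
  L0_class ((X : {mfun T >-> R}) + (Y : {mfun T >-> R})).
Definition L0_opp (X : L0 P) : L0 P := L0_class (- (X : {mfun T >-> R})).
Definition L0_scale (a : R) (X : L0 P) : L0 P :=
  L0_class (a *: (X : {mfun T >-> R})).

Lemma L0_class_add f g : L0_add (L0_class f) (L0_class g) = L0_class (f + g).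
Proof.
apply/L0_classP; apply: filterS2 (L0_classK f) (L0_classK g) => w fE gE.
by rewrite mfunD /= fE gE.
Qed.

Lemma L0_class_opp f : L0_opp (L0_class f) = L0_class (- f).
Proof.
by apply/L0_classP; apply: filterS (L0_classK f) => w fE; rewrite mfunN /= fE.
Qed.

Lemma L0_class_scale a f : L0_scale a (L0_class f) = L0_class (a *: f).
Proof.
apply/L0_classP; apply: filterS (L0_classK f) => w fE.
by congr (a * _).
Qed.

Let addA : associative L0_add.
Proof.
move=> X Y Z; rewrite -(L0_funK X) -(L0_funK Y) -(L0_funK Z).
by rewrite !L0_class_add addrA.
Qed.

Let addC : commutative L0_add.
Proof. by move=> X Y; rewrite /L0_add addrC. Qed.

Let add0 : left_id L0_zero L0_add.
Proof. by move=> X; rewrite -(L0_funK X) L0_class_add add0r. Qed.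

Let addN : left_inverse L0_zero L0_opp L0_add.
Proof.
by move=> X; rewrite -(L0_funK X) L0_class_opp L0_class_add addNr.
Qed.

HB.instance Definition _ := GRing.isZmodule.Build (L0 P) addA addC add0 addN.

Let scaleA a b X : L0_scale a (L0_scale b X) = L0_scale (a * b) X.
Proof. by rewrite -(L0_funK X) !L0_class_scale scalerA. Qed.

Let scale1 : left_id 1 L0_scale.
Proof. by move=> X; rewrite -(L0_funK X) L0_class_scale scale1r. Qed.

Let scaleDr : right_distributive L0_scale +%R.
Proof.
move=> a X Y; rewrite -(L0_funK X) -(L0_funK Y).
change (L0_scale a (L0_add (L0_class X) (L0_class Y)) =
  L0_add (L0_scale a (L0_class X)) (L0_scale a (L0_class Y))).
by rewrite !(L0_class_scale, L0_class_add) scalerDr.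
Qed.

Let scaleDl X : {morph L0_scale^~ X : a b / a + b}.
Proof.
move=> a b; rewrite -(L0_funK X).
change (L0_scale (a + b) (L0_class X) =
  L0_add (L0_scale a (L0_class X)) (L0_scale b (L0_class X))).
by rewrite !(L0_class_scale, L0_class_add) scalerDl.
Qed.

HB.instance Definition _ := GRing.Zmodule_isLmodule.Build R (L0 P)
  scaleA scale1 scaleDr scaleDl.

Lemma L0_addE X Y : {ae P, forall w, (X + Y : L0 P) w = X w + Y w}.
Proof. exact: L0_classK. Qed.

Lemma L0_scaleE a X : {ae P, forall w, (a *: X : L0 P) w = a * X w}.
Proof. exact: L0_classK. Qed.

End L0_vector_space.

Section L0_topology.
Context {d : measure_display} {T : measurableType d} {R : realType}.
Variable P : probability T R.
Implicit Types X Y Z : L0 P.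

(* Balls of the Ky Fan metric, which metrizes convergence in probability. *)
Definition L0_ball (X : L0 P) (e : R) (Y : L0 P) : Prop :=
  (P [set w | e <= `|X w - Y w|]%R < e%:E)%E.

Lemma measurable_dist_ge X Y (e : R) : measurable [set w | e <= `|X w - Y w|].
Proof.
rewrite -[X in measurable X]setTI.
have mXY : measurable_fun setT (fun w => `|X w - Y w|).
  by apply: measurableT_comp => //; exact: measurable_funB.
have := mXY measurableT `[e, +oo[%classic (measurable_itv _).
by congr (measurable _); apply/seteqP; split=> w /=; rewrite in_itv/= andbT.
Qed.

Let ent : set_system (L0 P * L0 P) := entourage_ L0_ball.
Let nbhs_L0 (X : L0 P) : set_system (L0 P) := nbhs_ ent X.
Let nbhs_L0E : nbhs_L0 = nbhs_ ent. Proof. by []. Qed.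

HB.instance Definition _ := hasNbhs.Build (L0 P) nbhs_L0.

Let ball_center X (e : R) : 0 < e -> L0_ball X e X.
Proof.
move=> e0; rewrite /L0_ball (_ : [set _ | _] = set0) ?measure0 ?lte_fin//.
by apply/seteqP; split=> // w /=; rewrite subrr normr0 leNgt e0.
Qed.

Let ball_sym X Y (e : R) : L0_ball X e Y -> L0_ball Y e X.
Proof. by rewrite /L0_ball; under eq_set do rewrite distrC. Qed.

Let ball_triangle X Y Z (e1 e2 : R) :
  L0_ball X e1 Y -> L0_ball Y e2 Z -> L0_ball X (e1 + e2) Z.
Proof.
rewrite /L0_ball => XY YZ; rewrite EFinD.
apply: le_lt_trans (lteD XY YZ).
apply: (le_trans _ (measureU2 _ (measurable_dist_ge _ _ _)
                               (measurable_dist_ge _ _ _))).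
apply: le_measure; rewrite ?inE; [|apply: measurableU|];
  try exact: measurable_dist_ge.
move=> w /= XZ; case: (leP e1 `|X w - Y w|) => [|XYw]; first by left.
right; rewrite /= leNgt; apply/negP => YZw; move: XZ; apply/negP.
by rewrite -ltNge (le_lt_trans (ler_distD (Y w) _ _))// ltrD.
Qed.

Let entE : ent = entourage_ L0_ball. Proof. by []. Qed.

HB.instance Definition _ := @Nbhs_isPseudoMetric.Build R (L0 P)
  ent nbhs_L0E L0_ball ball_center ball_sym ball_triangle entE.

Lemma cvg_in_probability (X_ : (L0 P)^nat) X :
  X_ @ \oo --> X <->
  forall e : R, 0 < e -> P [set w | e <= `|X_ n w - X w|] @[n --> \oo] --> 0%E.
Proof.
split=> [XX e e0|XX].
- apply: (proj2 (fine_cvgP _ _)); split.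
    by apply: nearW => n; rewrite fin_num_measure//; exact: measurable_dist_ge.
  apply/cvgrPdist_lt => r r0.
  pose s := Num.min e r.
  have s0 : 0 < s by rewrite lt_min e0.
  have XXs : \forall n \near \oo, ball X s (X_ n).
    exact: (XX _ (nbhsx_ballx X s s0)).
  apply: filterS XXs => n; rewrite /ball/= /L0_ball => Xn.
  rewrite sub0r normrN ger0_norm ?fine_ge0//.
  rewrite -lte_fin fineK; last first.
    by rewrite fin_num_measure//; exact: measurable_dist_ge.
  apply: (@le_lt_trans _ _ (P [set w | s <= `|X w - X_ n w|])); last first.
    by rewrite (lt_le_trans Xn)// lee_fin ge_min lexx orbT.
  apply: le_measure; rewrite ?inE; try exact: measurable_dist_ge.
  by move=> w /= ew; rewrite distrC (le_trans _ ew)// ge_min lexx.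
- apply/cvg_ballP => e e0.
  have [_ /cvgrPdist_lt/(_ _ e0)] := proj1 (fine_cvgP _ _) (XX e e0).
  apply: filterS => n; rewrite sub0r normrN ger0_norm ?fine_ge0//.
  rewrite -lte_fin fineK; last first.
    by rewrite fin_num_measure//; exact: measurable_dist_ge.
  by rewrite /ball/= /L0_ball; under eq_set do rewrite distrC.
Qed.

End L0_topology.

Section notions.
Context {d : measure_display} {T : measurableType d} {R : realType}.

Definition nonatomic (P : probability T R) : Prop :=
  forall A, measurable A -> (0 < P A)%E ->
    exists B, [/\ measurable B, B `<=` A, (0 < P B)%E & (P B < P A)%E].

Definition equivalent_measures (Q P : probability T R) : Prop :=
  Q `<< P /\ P `<< Q.

Variable P : probability T R.

Definition bounded_in_L1 (K : set (L0 P)) : Prop :=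
  (ereal_sup [set 'E_P[fun w => `|X w|%R] | X in K] < +oo)%E.

(* The supremum over K in lim_l sup_{X in K} E_Q[|X| 1_{|X| > l}] = 0 is
   unfolded, since ereal_sup set0 = -oo would exclude K = set0. When Q is
   equivalent to P the integrals do not depend on the representative of X. *)
Definition uniformly_integrable (Q : probability T R) (K : set (L0 P)) : Prop :=
  forall e : R, 0 < e -> \forall l \near +oo%R, forall X : L0 P, K X ->
    (\int[Q]_(w in [set w | (l < `|X w|)%R]) `|X w|%:E <= e%:E)%E.

Definition solid (W : set (L0 P)) : Prop :=
  forall X Y : L0 P, W X -> {ae P, forall w, `|Y w| <= `|X w|} -> W Y.

Definition convex_solid (W : set (L0 P)) : Prop := convex_set W /\ solid W.

(* [subspace A] is the type L0 P with the relative topology of A. *)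
Definition uniformly_locally_convex_solid (A S : set (L0 P)) : Prop :=
  forall U : set (L0 P), nbhs (0 : L0 P) U ->
    exists W : set (L0 P), [/\ convex_solid W, W `<=` U &
      forall X : L0 P, S X ->
        nbhs (X : subspace A) ([set X + Z | Z in W] `&` A)].

End notions.

(* Main.v *)
(* Idea of the proof, for A the closure of K.

   From local convex-solidity to uniform integrability. A convex-solid set W of
   random variables that are small in probability carries a function g, equal
   to about 1 outside a small event, such that E[g |Z|] is small for all Z in W.
   Doing this for a sequence of neighbourhoods produces a weight 0 < h <= 1 such
   that E[h |Y - X|] -> 0 whenever Y -> X in probability inside A. Under such a
   weight K is uniformly integrable: otherwise take X_k in K whose tails
   {|X_k| > l_k} carry almost the maximal asymptotic tail mass c, with l_k
   growing so fast that the tail sets are essentially disjoint. Some convex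
   combinations of X_n, X_(n+1), ... converge in probability (strict convexity
   of E sqrt(1 + Y^2)), but testing against the signs of the X_k on their tails
   shows that they keep weighted mass at least c / 2 on vanishing events, so
   they do not converge for E[h |.|]. The measure Q has density h / E[h].

   Conversely, for Q as in (2) the sets {Z : E_Q |Z| <= delta} are convex-solid
   and small in probability, and by uniform integrability they contain Y - X
   as soon as X and Y in A are close in probability, uniformly in X. *)

From HB Require Import structures.
Require Import Defs.
From mathcomp Require Import all_boot all_order all_algebra.
From mathcomp Require Import all_classical all_reals all_analysis.
From mathcomp Require Import measurable_realfun ring lra.

Set Implicit Arguments.
Unset Strict Implicit.
Unset Printing Implicit Defensive.

Import Order.TTheory GRing.Theory Num.Theory.
Import numFieldNormedType.Exports.

Local Open Scope classical_set_scope.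
Local Open Scope ring_scope.

(** * Integration and convergence in probability *)

(** Order of choices. The contradiction in the hump argument occurs at the limit [Z] of the convex
    combinations, which is built after the weight and only from it. The weight must therefore serve
    all points of the closure at once. This is what uniformity provides: the convex-solid set is
    fixed before the centre [X], so its density [g] does not depend on [X]; only the radius does.
    The L1 bound gives convergence in probability and no more, so [Z] is known to lie only in the
    L0-closure of [K].

    Obstacle for [g]. Elements of a convex-solid set that is small in probability need not be
    integrable, let alone bounded in L1, so a bounded functional is minimised over it. Its
    derivative at the minimum weighs every [|Z|] by the square of the optimal value of
    [1 / (1 + a |Z|)].

    Why the maximal tail mass. No element of [K] has much more than [c] beyond a fixed level [lhat],
    while hump [j] already has nearly [c] beyond [l j]. The part of [|X j|] between the two levels
    is thus small, and what lies below [lhat] is small on the other tail sets because these have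
    small probability. *)

Section integration.
Context d (T : measurableType d) (R : realType) (P : probability T R).
Implicit Types f g : T -> R.

Lemma integrable_dominated f g : measurable_fun setT f ->
  P.-integrable setT (EFin \o g) -> {ae P, forall w, `|f w| <= g w} ->
  P.-integrable setT (EFin \o f).
Proof.
move=> mf /integrableP[mg goo] fg; apply/integrableP; split.
  exact/measurable_EFinP.
apply: le_lt_trans goo; apply: ae_ge0_le_integral => //.
- by do 2 apply: measurableT_comp => //.
- by apply: measurableT_comp.
- apply: filterS fg => w fg _ /=; rewrite lee_fin.
  by rewrite (le_trans fg)// ler_norm.
Qed.

Lemma integrable_bounded f (M : R) : measurable_fun setT f ->
  (forall w, `|f w| <= M) -> P.-integrable setT (EFin \o f).
Proof.
move=> mf fM; apply: (@integrable_dominated _ (cst M)) => //.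
  exact: finite_measure_integrable_cst.
exact: aeW.
Qed.

Lemma le_Rintegral_ae f g : P.-integrable setT (EFin \o f) ->
  P.-integrable setT (EFin \o g) -> {ae P, forall w, f w <= g w} ->
  \int[P]_w f w <= \int[P]_w g w.
Proof.
move=> If Ig fg.
have mf : measurable_fun setT f by apply/measurable_EFinP; case/integrableP: If.
have mg : measurable_fun setT g by apply/measurable_EFinP; case/integrableP: Ig.
(* [le_Rintegral] asks for a pointwise inequality, so [f] is replaced by an a.e. equal function that
   is below [g] everywhere. *)
have -> : \int[P]_w f w = \int[P]_w Num.min (f w) (g w).
  congr fine; apply: ae_eq_integral => //.
  - exact/measurable_EFinP.
  - by apply/measurable_EFinP; exact: measurable_minr.
  - by apply: filterS fg => w fg _ /=; rewrite min_l.
apply: le_Rintegral => //.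
  apply: (@integrable_dominated _ (fun w => `|f w| + `|g w|)).
  - exact: measurable_minr.
  - by rewrite (_ : _ \o _ = (abse \o (EFin \o f)) \+ (abse \o (EFin \o g)))//;
      apply: integrableD => //; exact: integrable_abse.
  - by apply: aeW => w; case: (leP (f w) (g w)) => _; rewrite ?lerDl ?lerDr.
by move=> w _; rewrite ge_min lexx orbT.
Qed.

Lemma Rintegral_probability_cst (c : R) : \int[P]_w c = c.
Proof. by rewrite Rintegral_cst//= probability_setT mulr1. Qed.

Lemma integrableD_EFin f g : P.-integrable setT (EFin \o f) ->
  P.-integrable setT (EFin \o g) ->
  P.-integrable setT (EFin \o (fun w => f w + g w)).
Proof.
by move=> ? ?; exact: (@integrableD _ _ _ P setT measurableT (EFin \o f) (EFin
  \o g)).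
Qed.

Lemma integrableZ_EFin f (c : R) : P.-integrable setT (EFin \o f) ->
  P.-integrable setT (EFin \o (fun w => c * f w)).
Proof.
by move=> ?; exact: (@integrableZl _ _ _ P setT measurableT c (EFin \o f)).
Qed.

Lemma integrable_norm_EFin f : P.-integrable setT (EFin \o f) ->
  P.-integrable setT (EFin \o (fun w => `|f w|)).
Proof. exact: integrable_abse. Qed.

Lemma integrable_measurable f : P.-integrable setT (EFin \o f) ->
  measurable_fun setT f.
Proof. by move=> /integrableP[/measurable_EFinP]. Qed.

Lemma EFin_Rintegral f : P.-integrable setT (EFin \o f) ->
  ((\int[P]_w f w)%:E = \int[P]_w (f w)%:E)%E.
Proof. by move=> If; rewrite fineK//; exact: integrable_fin_num. Qed.

(** Fatou's lemma, in the form that passes a common bound on truncations to the limit without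
    assuming the limit integrable. *)
Lemma integral_le_cvg (mu : {measure set T -> \bar R}) (f_ : nat -> T -> R) f
    (c : \bar R) :
  (forall n, measurable_fun setT (f_ n)) -> (forall n w, 0 <= f_ n w) ->
  (forall w, f_ n w @[n --> \oo] --> f w) ->
  (forall n, \int[mu]_w (f_ n w)%:E <= c)%E -> (\int[mu]_w (f w)%:E <= c)%E.
Proof.
move=> mf f0 fcvg fc.

have fE w : (f w)%:E = limn_einf (fun n => (f_ n w)%:E).
  have cv : (f_ n w)%:E @[n --> \oo] --> (f w)%:E by apply: cvg_EFin => //;
    [exact: nearW|exact: fcvg].
  rewrite is_cvg_limn_einfE; last by apply/cvg_ex; exists (f w)%:E.
  by rewrite (cvg_lim _ cv).
under eq_integral do rewrite fE.
apply: le_trans (fatou mu measurableT _ _) _.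
- by move=> n; apply/measurable_EFinP.
- by move=> n w _; rewrite lee_fin.
- have := @limn_einf_sup R (fun n => \int[mu]_w (f_ n w)%:E)%E => /le_trans;
    apply.
  rewrite limn_esup_lim; apply: lime_le.
    exact: is_cvg_esups.
  by apply: nearW => n; apply: ge_ereal_sup => _ [k _ <-].
Qed.

Lemma markov_Rintegral f (c : R) : P.-integrable setT (EFin \o f) ->
  (forall w, 0 <= f w) -> 0 < c ->
  (P [set w | c <= f w]%R <= (\int[P]_w f w / c)%:E)%E.
Proof.
move=> If f0 c0; have mf := integrable_measurable If.
have := @le_integral_comp_abse _ _ _ P setT measurableT (EFin \o f) c id.
move=> /(_ (@measurable_id _ _ _) (fun r h => h) (fun x y _ _ h => h)).
move=> /(_ (proj2 (measurable_EFinP _ _) mf) c0).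
have -> : setT `&` [set x | (c%:E <= `|(EFin \o f) x|)%E] = [set w | c <= f w].
  by rewrite setTI; apply/seteqP; split=> w /=; rewrite lee_fin ger0_norm.
under eq_integral do rewrite /= ger0_norm//.
rewrite -EFin_Rintegral// => h.
have Pfin : P [set w | c <= f w]%R \is a fin_num.
  apply: fin_num_measure.
  have -> : [set w | c <= f w] = setT `&` f @^-1` `[c, +oo[%classic.
    by rewrite setTI; apply/seteqP; split=> w /=; rewrite in_itv/= andbT.
  exact: mf.
by move: h => /=; rewrite -(fineK Pfin) -EFinM !lee_fin ler_pdivlMr// mulrC.
Qed.
End integration.

(** * Completeness of convergence in probability *)

Section completeness.
Context d (T : measurableType d) (R : realType) (P : probability T R).
Implicit Types f g h : {mfun T >-> R}.

Lemma measurable_ge_dist f g (e : R) : measurable [set w | e <= `|f w - g w|].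
Proof.
have -> : [set w | e <= `|f w - g w|] =
    setT `&` (fun w => `|f w - g w|) @^-1` `[e, +oo[%classic.
  by rewrite setTI; apply/seteqP; split=> w /=; rewrite in_itv/= andbT.
have mfg : measurable_fun setT (fun w => `|f w - g w|).
  by apply: measurableT_comp => //; exact: measurable_funB.
exact: mfg.
Qed.

Lemma dist_lt_triangle f g h (e1 e2 : R) :
  (P [set w | e1 <= `|f w - g w|]%R < e1%:E)%E ->
  (P [set w | e2 <= `|g w - h w|]%R < e2%:E)%E ->
  (P [set w | e1 + e2 <= `|f w - h w|]%R < (e1 + e2)%:E)%E.
Proof.
move=> fg gh; rewrite EFinD; apply: le_lt_trans (lteD fg gh).
apply: (le_trans _ (measureU2 P (measurable_ge_dist f g e1)
                                (measurable_ge_dist g h e2))).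
apply: le_measure.
- by rewrite inE; exact: measurable_ge_dist.
- by rewrite inE; apply: measurableU; exact: measurable_ge_dist.
move=> w /= fh; case: (leP e1 `|f w - g w|) => [|fgw]; first by left.
right; rewrite /= leNgt; apply/negP => ghw; move: fh; apply/negP.
by rewrite -ltNge (le_lt_trans (ler_distD (g w) _ _))// ltrD.
Qed.

Lemma le_prob_ge_dist f g (a b : R) : a <= b ->
  (P [set w | b <= `|f w - g w|]%R <= P [set w | a <= `|f w - g w|]%R)%E.
Proof.
move=> ab; apply: le_measure; rewrite ?inE; try exact: measurable_ge_dist.
by move=> w /=; exact: le_trans.
Qed.

Lemma geometric_half_lt (e : R) : 0 < e ->
  exists k0, forall k, (k0 <= k)%N -> 2 * 2^-1 ^+ k < e.
Proof.
move=> e0; have : (2 * 2^-1 ^+ k : R) @[k --> \oo] --> (0 : R).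
  rewrite -[X in _ --> X](mulr0 2); apply: cvgMr.
  by apply: cvg_expr; rewrite ger0_norm ?invr_ge0// invf_lt1// ltr1n.
move/cvgrPdist_lt => /(_ e e0) [k0 _ h]; exists k0 => k /h.
by rewrite sub0r normrN; apply: le_lt_trans; exact: ler_norm.
Qed.

Lemma borel_cantelli_geometric (B : nat -> set T) (c : R) :
  (forall k, measurable (B k)) ->
  (forall k, (P (B k) <= (c * 2^-1 ^+ k)%:E)%E) -> P (lim_sup_set B) = 0%E.
Proof.
move=> mB PB; apply: lim_sup_set_cvg0 => //.
apply: (@le_lt_trans _ _ (2 * c)%:E); last exact: ltry.
apply: lime_le; first exact: is_cvg_nneseries.
have c0 : 0 <= c.
  by have := le_trans (measure_ge0 _ _) (PB 0%N); rewrite expr0 mulr1 lee_fin.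
apply: nearW => n; apply: (@le_trans _ _ (2 * c - 2 * c * 2^-1 ^+ n)%:E).
  elim: n => [|n IH]; first by rewrite big_geq// expr0 mulr1 subrr.
  rewrite big_nat_recr//=; apply: le_trans (leeD IH (PB n)) _.
  by rewrite -EFinD lee_fin exprS; lra.
by rewrite lee_fin gerBl !mulr_ge0// exprn_ge0// invr_ge0.
Qed.

Lemma fast_cauchy_dist (u : nat -> R) n :
  (forall k, (n <= k)%N -> `|u k - u k.+1| < 2^-1 ^+ k) ->
  forall k j, (n <= k)%N -> `|u k - u (k + j)%N| <= 2 * 2^-1 ^+ k.
Proof.
move=> un k j nk.
(* The subtracted remainder of the geometric series makes the induction on [j] close. *)
suff : `|u k - u (k + j)%N| <= 2 * 2^-1 ^+ k - 2 * 2^-1 ^+ (k + j).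
  by move=> /le_trans; apply; rewrite gerBl mulr_ge0// exprn_ge0// invr_ge0.
elim: j => [|j IH]; first by rewrite addn0 !subrr normr0.
apply: le_trans (ler_distD (u (k + j)%N) _ _) _.
have := un (k + j)%N (leq_trans nk (leq_addr _ _)).
rewrite -addnS => /ltW /(lerD IH) /le_trans; apply.
by rewrite addnS exprS; lra.
Qed.

Lemma fast_cauchy_cvg (u : nat -> R) n :
  (forall k, (n <= k)%N -> `|u k - u k.+1| < 2^-1 ^+ k) -> cvgn u.
Proof.
move=> un; apply/cauchy_cvgP/cauchyP => e e0.
have [k0 k0e] := geometric_half_lt e0.
have [nk ke] := (leq_maxl n k0, k0e _ (leq_maxr n k0));
  set k := maxn n k0 in nk ke.
exists (u k); exists k => // j /= kj; rewrite /ball/=.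
apply: le_lt_trans ke; have := fast_cauchy_dist un (j - k) nk.
by rewrite subnKC.
Qed.

(** A fast subsequence converges a.e. by Borel-Cantelli, and the Cauchy property carries the other
    terms along. The lemma is about functions and not classes, so that it also applies to the
    bounded functions [q (z n)] of [solid_density]. *)
Lemma cauchy_in_probability_cvg (f : nat -> {mfun T >-> R}) :
  (forall e : R, 0 < e -> exists N, forall m n, (N <= m)%N -> (N <= n)%N ->
    (P [set w | e <= `|f m w - f n w|]%R < e%:E)%E) ->
  exists g : {mfun T >-> R}, forall e : R, 0 < e -> exists N, forall n,
    (N <= n)%N -> (P [set w | e <= `|f n w - g w|]%R < e%:E)%E.
Proof.
move=> fC.
have p0 (k : nat) : 0 < 2^-1 ^+ k :> R by rewrite exprn_gt0// invr_gt0.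
have /choice[phi phiP] : forall k, exists N, forall m n, (N <= m)%N ->
    (N <= n)%N -> (P [set w | 2^-1 ^+ k <=
      `|f m w - f n w|]%R < (2^-1 ^+ k)%:E)%E.
  by move=> k; exact: fC.
(* Partial sums give indices that are monotone and still above [phi k]. *)
pose psi k := (\sum_(i < k.+1) phi i)%N.
have phi_psi k : (phi k <= psi k)%N by rewrite /psi big_ord_recr leq_addl.
have psiS k : (psi k <= psi k.+1)%N by rewrite {2}/psi big_ord_recr leq_addr.
pose Z k := f (psi k).
pose B k := [set w | 2^-1 ^+ k <= `|Z k w - Z k.+1 w|].
have mB k : measurable (B k) by exact: measurable_ge_dist.
have PB k : (P (B k) < (2^-1 ^+ k)%:E)%E.
  by apply: phiP => //; exact: leq_trans (psiS k).
have NB : P (lim_sup_set B) = 0%E.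
  by apply: (@borel_cantelli_geometric _ 1) => // k; rewrite mul1r ltW.
pose D := ~` lim_sup_set B.
have mL : measurable (lim_sup_set B).
  by apply: bigcap_measurable => // k _; exact: bigcup_measurable.
have mD : measurable D by exact: measurableC.
have DP w n : ~ (\bigcup_(j >= n) B j) w -> forall k, (n <= k)%N ->
   `|Z k w - Z k.+1 w| < 2^-1 ^+ k.
  move=> nB k nk; rewrite ltNge; apply/negP => Bk; apply: nB.
  by exists k.
(* Cutting off the exceptional null set makes the sequence converge at every point, so that its
   limit is a measurable function. *)
pose F k w := \1_D w * Z k w.
have Fcvg w : cvgn (F^~ w).
  have [Dw|Dw] := pselect (D w).
    have /existsNP[n /not_implyP[_ nB]] := Dw.
    apply: (@fast_cauchy_cvg _ n) => k nk; rewrite /F indicE mem_set// !mul1r.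
    exact: DP nB _ nk.
  rewrite (_ : F^~ w = cst 0); first exact: is_cvg_cst.
  by apply/funext => k; rewrite /F indicE memNset// mul0r.
pose g0 w := limn (F^~ w).
have mg0 : measurable_fun setT g0.
  apply: (@measurable_fun_cvg _ _ _ _ F) => // k.
  by apply: measurable_funM => //; exact: measurable_indic.
pose g : {mfun T >-> R} := HB.pack g0 (isMeasurableFun.Build _ _ _ _ _ mg0).
exists g => e e0.
have [k [k1 k2]] : exists k : nat, 2 * 2^-1 ^+ k < e / 2 /\
   (P (\bigcup_(j >= k) B j) < (e / 2)%:E)%E.
  have e20 : 0 < e / 2 by rewrite divr_gt0.
  have [k0 k0e] := geometric_half_lt e20.
  have fin A : measurable A -> P A \is a fin_num.
    by move=> mA; exact: fin_num_measure.
  have mU n : measurable (\bigcup_(j >= n) B j) by exact: bigcup_measurable.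
  have : P (\bigcup_(j >= n) B j) @[n --> \oo] --> 0%E.
    by rewrite -NB; apply: lim_sup_set_cvg => //; rewrite -ge0_fin_numE// fin.
  move=> /fine_cvgP[_] /cvgrPdist_lt/(_ _ e20)[k1 _ k1e].
  exists (maxn k0 k1); split; first by rewrite k0e// leq_maxl.
  have := k1e _ (leq_maxr k0 k1); rewrite sub0r normrN /= => h.
  by rewrite -(fineK (fin _ (mU _))) lte_fin (le_lt_trans (ler_norm _) h).
have k1' : 2^-1 ^+ k <= e / 2.
  by apply: le_trans (ltW k1); rewrite ler_peMl// ?(ltW (p0 k))// ler1n.
exists (psi k) => n kn.
rewrite [e]splitr; apply: (@dist_lt_triangle _ (Z k)).
- apply: (le_lt_trans (le_prob_ge_dist _ _ k1')).
  apply: (@lt_le_trans _ _ (2^-1 ^+ k)%:E); last by rewrite lee_fin.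
  by apply: phiP => //; exact: leq_trans (phi_psi k) kn.
- apply: le_lt_trans k2; apply: le_measure; rewrite ?inE.
  + exact: measurable_ge_dist.
  + by apply: bigcup_measurable.
  move=> w /= ew; apply: contrapT => nB; move: ew; apply/negP; rewrite -ltNge.
  apply: le_lt_trans k1.
  have Dw : D w by move=> /(_ k I).
  have cv : `|F m w - Z k w| @[m --> \oo] --> `|g w - Z k w|.
    by apply: cvg_norm; apply: cvgB; [exact: Fcvg|exact: cvg_cst].
  rewrite distrC -(cvg_lim _ cv)//; apply: limr_le.
    by apply/cvg_ex; exists `|g w - Z k w|.
  exists k => // m /= km; rewrite /F indicE mem_set// mul1r distrC.
  by rewrite -(subnKC km); apply: (@fast_cauchy_dist (Z^~ w) k) => // ;
    exact: DP.
Qed.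
End completeness.

(** * Densities attached to small convex-solid sets *)

Section inverse_inequalities.
Context (R : realType).
Implicit Types t u v : R.

(** Quantitative midpoint convexity of the inverse on [[1, +oo[], since [8 / (u + v)] is four times
    the inverse of the midpoint. The gap controls the distance between the inverses, which stay
    bounded when [u] and [v] do not. *)
Lemma inv_gap u v : 1 <= u -> 1 <= v ->
  (u^-1 - v^-1) ^+ 2 + 8 / (u + v) <= 2 * (u^-1 + v^-1).
Proof.
move=> u1 v1; rewrite -subr_ge0.
have u0 : u != 0 by rewrite gt_eqF// (lt_le_trans ltr01).
have v0 : v != 0 by rewrite gt_eqF// (lt_le_trans ltr01).
have uv0 : u + v != 0 by rewrite gt_eqF//; lra.
rewrite [leRHS](_ : _ =
    (u - v) ^+ 2 * (2 * u * v - (u + v)) / ((u * v) ^+ 2 * (u + v)));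
      last first.
  by field; rewrite u0 v0 uv0.
apply: divr_ge0; last by rewrite mulr_ge0 ?sqr_ge0//; lra.
by apply: mulr_ge0; [exact: sqr_ge0|nra].
Qed.

(** First-order expansion of the inverse from [u] towards [v]: the derivative is [u^-1 - v / u^2]
    with [u^-1 <= 1], and the factor [1 + t * V] pays for the second order. If [u] nearly minimises
    the mean of the inverse, integrating this bounds the mean of [v / u^2] by about 1. *)
Lemma inv_secant t u v (V : R) : 1 <= u -> 1 <= v -> v <= V -> 0 < t -> t < 1 ->
  ((1 - t) * u + t * v)^-1 + t / (1 + t * V) * (v * u^-1 ^+ 2) <= u^-1 + t.
Proof.
move=> u1 v1 vV t0 t1; set w := (1 - t) * u + t * v.
have w1 : 1 <= w by rewrite /w; nra.
have wu : w <= u * (1 + t * V).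
  have uV : v <= u * V by nra.
  have : t * v <= t * (u * V) by rewrite ler_pM2l.
  have : 0 <= t * u by nra.
  rewrite /w; nra.
have [u0 v0 w0] : [/\ 0 < u, 0 < v & 0 < w] by split; lra.
have -> : w^-1 = u^-1 + t * w^-1 - t * (v / (u * w)).
  by rewrite /w in w0 *; field; rewrite !gt_eqF.
have V0 : 0 < 1 + t * V by nra.
have h1 : t * w^-1 <= t by rewrite ger_pMr// invf_le1.
suff : t / (1 + t * V) * (v * u^-1 ^+ 2) <= t * (v / (u * w)) by lra.
rewrite [leLHS](_ : _ = t * (v / (u * (u * (1 + t * V))))); last first.
  by field; rewrite !gt_eqF.
rewrite ler_pM2l// ler_pM2l// lef_pV2 ?posrE ?mulr_gt0//.
by rewrite ler_pM2l.
Qed.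

End inverse_inequalities.

(** * A density from a minimisation over a convex-solid set *)

Section solid_sets.
Context d (T : measurableType d) (R : realType) (P : probability T R).

Lemma measurable_inv_ge0 (f : T -> R) : measurable_fun setT f ->
  (forall w, 0 <= f w) -> measurable_fun setT (fun w => (f w)^-1).
Proof.
move=> mf f0; rewrite (_ : (fun w => _) = (@powR R ^~ (-1)) \o f); last first.
  by apply/funext => w; rewrite /= powR_inv1.
by apply: measurableT_comp => //; exact: measurable_powR.
Qed.

Lemma convex_set_comb (K : set (L0 P)) (X Y : L0 P) (t : R) :
  convex_set K -> K X -> K Y -> 0 <= t -> t <= 1 ->
  K ((1 - t) *: X + t *: Y).
Proof.
move=> cK KX KY t0 t1.
have := cK Y X (Itv01 t0 t1); rewrite !inE => /(_ KY KX).
by congr K; rewrite addrC.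
Qed.

(** Lets the minimisation work with pointwise operations and inequalities on functions rather than
    a.e. ones on classes. *)
Definition represented (W : set (L0 P)) (f : T -> R) :=
  measurable_fun setT f /\ exists2 X : L0 P, W X & {ae P, forall w, X w = f w}.

Lemma represented_L0 (W : set (L0 P)) (X : L0 P) : W X -> represented W X.
Proof. by move=> WX; split => //; exists X => //; exact: aeW. Qed.

Lemma represented_solid (W : set (L0 P)) (f g : T -> R) : solid W ->
  represented W f -> measurable_fun setT g -> (forall w, `|g w| <= `|f w|) ->
  represented W g.
Proof.
move=> sW [_ [X WX Xf]] mg gf; split => //.
pose g' : {mfun T >-> R} := HB.pack g (isMeasurableFun.Build _ _ _ _ _ mg).
exists (L0_class P g'); last exact: L0_classK.
apply: sW WX _; apply: filterS2 Xf (L0_classK P g') => w -> ->; exact: gf.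
Qed.

Lemma represented_convex (W : set (L0 P)) (f g : T -> R) (t : R) :
  convex_set W -> represented W f -> represented W g -> 0 <= t -> t <= 1 ->
  represented W (fun w => (1 - t) * f w + t * g w).
Proof.
move=> cW [mf [X WX Xf]] [mg [Y WY Yg]] t0 t1; split.
  by apply: measurable_funD; exact: measurable_funM.
exists ((1 - t) *: X + t *: Y); first exact: convex_set_comb.
have XY := L0_addE ((1 - t) *: X) (t *: Y).
near=> w; rewrite (near XY w)//.
rewrite (near (L0_scaleE (1 - t) X) w)// (near (L0_scaleE t Y) w)//.
by rewrite (near Xf w)// (near Yg w).
Unshelve. all: by end_near. Qed.

Lemma measurable_set_ge (f : T -> R) (c : R) : measurable_fun setT f ->
  measurable [set w | c <= f w].
Proof.
move=> mf; have -> : [set w | c <= f w] = setT `&` f @^-1` `[c, +oo[%classic.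
  by rewrite setTI; apply/seteqP; split=> w /=; rewrite in_itv/= andbT.
exact: mf.
Qed.

Lemma measurable_set_gt (f : T -> R) (c : R) : measurable_fun setT f ->
  measurable [set w | c < f w].
Proof.
move=> mf; have -> : [set w | c < f w] = setT `&` f @^-1` `]c, +oo[%classic.
  by rewrite setTI; apply/seteqP; split=> w /=; rewrite in_itv/= andbT.
exact: mf.
Qed.

Lemma measurable_set_lt (f : T -> R) (c : R) : measurable_fun setT f ->
  measurable [set w | f w < c].
Proof.
move=> mf; have -> : [set w | f w < c] = setT `&` f @^-1` `]-oo, c[%classic.
  by rewrite setTI; apply/seteqP; split=> w /=; rewrite in_itv.
exact: mf.
Qed.

Lemma le_measure_ae (A B : set T) : measurable A -> measurable B ->
  {ae P, forall w, A w -> B w} -> (P A <= P B)%E.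
Proof.
move=> mA mB AB; rewrite -[A]setIT -[B]setIT -!integral_indic//.
apply: ae_ge0_le_integral => //.
- by apply/measurable_EFinP; exact: measurable_indic.
- by apply/measurable_EFinP; exact: measurable_indic.
- apply: filterS AB => w AB _; rewrite lee_fin !indicE ler_nat.
  by case: (boolP (w \in A)) => //; rewrite inE => /AB/mem_set ->.
Qed.

(** The distance is at most [e] off the event and at most 1 on it. *)
Lemma Rintegral_dist_le (f g : T -> R) (e : R) :
  measurable_fun setT f -> measurable_fun setT g -> 0 <= e ->
  (forall w, `|f w - g w| <= 1) ->
    (P [set w | e <= `|f w - g w|]%R <= e%:E)%E ->
  \int[P]_w `|f w - g w| <= 2 * e.
Proof.
move=> mf mg e0 fg1 Pe.
have md : measurable_fun setT (fun w => `|f w - g w|).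
  by apply: measurableT_comp => //; exact: measurable_funB.
have mE := measurable_set_ge e md.
set E := [set w | _] in Pe mE.
have IE : P.-integrable setT (EFin \o (\1_E : T -> R)).
  by apply: integrable_indic => //; rewrite ltey_eq fin_num_measure.
have Ie : P.-integrable setT (EFin \o (cst e : T -> R)).
  exact: finite_measure_integrable_cst.
apply: (@le_trans _ _ (\int[P]_w (e + \1_E w))).
  apply: le_Rintegral => //.
  - by apply: (@integrable_bounded _ _ _ _ _ 1) => // w; rewrite normr_id.
  - exact: integrableD_EFin.
  move=> w _; case: (leP e `|f w - g w|) => h.
    by rewrite indicE mem_set//= (le_trans (fg1 w))// lerDr.
  by rewrite (le_trans (ltW h))// lerDl indicE.
rewrite RintegralD// Rintegral_probability_cst mulr2n mulrDl !mul1r lerD2l.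
by rewrite -lee_fin EFin_Rintegral// integral_indic// setIT.
Qed.

Lemma dist_clip01 (x y : R) : 0 <= x <= 1 ->
  `|x - Num.max 0 (Num.min 1 y)| <= `|x - y|.
Proof.
move=> /andP[x0 x1]; have h1 := ler_norm (x - y); have h2 := ler_norm (y - x).
rewrite (distrC y) in h2; rewrite ler_norml.
have [y1|y1] := leP 1 y; first by rewrite max_r//; apply/andP; split; lra.
by have [y0|y0] := leP 0 y; apply/andP; split; lra.
Qed.

Lemma natSinv_lt (e : R) : 0 < e ->
  exists N, forall n, (N <= n)%N -> n.+1%:R^-1 < e.
Proof.
move=> e0; exists (Num.bound e^-1) => n Nn.
rewrite invf_plt ?posrE//; apply: (@lt_le_trans _ _ (Num.bound e^-1)%:R).
  by apply: Num.Theory.archi_boundP; rewrite invr_ge0 ltW.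
by rewrite ler_nat (leq_trans Nn).
Qed.

(* For a minimising sequence Z_n of [E (1 / (1 + a |Z|))] over W, strict
   convexity makes [1 / (1 + a |Z_n|)] converge, although |Z_n| itself may
     escape to
   infinity; g is the square of the limit, and the bound on [E (g |Z|)] is the
   first-order optimality condition. *)
Lemma solid_density (W : set (L0 P)) (a e : R) :
  convex_solid W -> W 0 -> 0 < a -> 0 < e -> a * e <= 1 ->
  (forall Z, W Z -> (P [set w | e <= `|Z w|]%R < e%:E)%E) ->
  exists g : T -> R, [/\ measurable_fun setT g, forall w, 0 <= g w <= 1,
    (P [set w | g w < 16^-1]%R <= (2 * e)%:E)%E &
    forall Z, W Z -> P.-integrable setT (EFin \o Z) ->
      \int[P]_w (g w * `|Z w|) <= a^-1].
Proof.
move=> [cW sW] W0 a0 e0 ae1 We.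
pose S f := represented W f /\ forall w, 0 <= f w.
pose q (f : T -> R) w := (1 + a * f w)^-1.
have u1 f w : S f -> 1 <= 1 + a * f w by move=> [_ f0];
  rewrite lerDl mulr_ge0// ltW.
have q0 f w : S f -> 0 < q f w by move=> Sf;
  rewrite invr_gt0 (lt_le_trans _ (u1 _ w Sf)).
have q1 f w : S f -> q f w <= 1.
  by move=> Sf; rewrite invf_le1 ?u1// (lt_le_trans _ (u1 _ w Sf)).
have mq f : S f -> measurable_fun setT (q f).
  move=> Sf; apply: measurable_inv_ge0; last first.
    by move=> w; rewrite (le_trans _ (u1 _ w Sf)).
  by have [[mf _] _] := Sf; apply: measurable_funD => //;
    exact: measurable_funM.
have Iq f : S f -> P.-integrable setT (EFin \o q f).
  move=> Sf; apply: (@integrable_bounded _ _ _ _ _ 1); first exact: (mq _).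
  by move=> w; rewrite gtr0_norm ?q1 ?q0.
pose J f := \int[P]_w q f w.
pose I := inf (J @` S).
have SJ : has_inf (J @` S).
  split.
    exists (J (cst 0)), (cst 0) => //; split => //.
    apply: (represented_solid sW (represented_L0 W0)) => // w.
    by rewrite normr0 normr_ge0.
  by exists 0 => _ [f Sf <-]; apply: Rintegral_ge0 => w _; rewrite ltW ?q0.
have IJ f : S f -> I <= J f.
  by move=> Sf; apply: ge_inf; [case: SJ|exists f].
have /choice[z zP] : forall n, exists f, S f /\ J f < I + n.+1%:R^-1.
  move=> n; have n0 : 0 < n.+1%:R^-1 :> R by rewrite invr_gt0.
  by have [_ [f Sf <-] fI] := inf_adherent n0 SJ; exists f.
have Sz n : S (z n) by case: (zP n).
have Jz n : J (z n) <= I + n.+1%:R^-1 by case: (zP n) => _ /ltW.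
have Scomb f g t : S f -> S g -> 0 <= t -> t <= 1 ->
    S (fun w => (1 - t) * f w + t * g w).
  move=> [Wf f0] [Wg g0] t0 t1; split; first exact: represented_convex.
  by move=> w; rewrite addr_ge0// mulr_ge0// subr_ge0.
(* The midpoint of [z n] and [z m] is again in [S], so its value is at least [I]; [inv_gap] then
   turns two nearly minimal values into L2 closeness of the inverses. *)
have qL2 n m : \int[P]_w (q (z n) w - q (z m) w) ^+ 2 <=
    2 * (n.+1%:R^-1 + m.+1%:R^-1).
  pose y w := (1 - 2^-1) * z n w + 2^-1 * z m w.
  have Sy : S y by apply: Scomb => //; lra.
  have Id : P.-integrable setT (EFin \o (fun w => (q (z n) w - q (z m) w) ^+
    2)).
    apply: (@integrable_bounded _ _ _ _ _ 1).
      by apply: measurable_funX; apply: measurable_funB; exact: (mq _).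
    move=> w; rewrite ger0_norm ?sqr_ge0//.
    have := q0 _ w (Sz n); have := q0 _ w (Sz m).
    have := q1 _ w (Sz n); have := q1 _ w (Sz m); nra.
  have : \int[P]_w ((q (z n) w - q (z m) w) ^+ 2 + 4 * q y w) <=
      \int[P]_w (2 * (q (z n) w + q (z m) w)).
    apply: le_Rintegral => //.
    - by apply: integrableD_EFin => //; apply: integrableZ_EFin; exact: Iq.
    - by apply: integrableZ_EFin; apply: integrableD_EFin; exact: Iq.
    move=> w _; apply: le_trans (inv_gap (u1 _ w (Sz n)) (u1 _ w (Sz m))).
    rewrite lerD2l /q /y.
    have := u1 _ w (Sz n); have := u1 _ w (Sz m).
    set A := z n w; set B := z m w => hB hA.
    rewrite le_eqVlt; apply/orP; left; apply/eqP.
    rewrite (_ : 1 + a * _ = (1 + a * A + (1 + a * B)) / 2); last by field.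
    by rewrite invf_div; lra.
  rewrite RintegralD//; last by apply: integrableZ_EFin; exact: Iq.
  rewrite !RintegralZl//; first last.
  - exact: Iq.
  - by apply: integrableD_EFin; exact: Iq.
  rewrite RintegralD//; [|exact: Iq|exact: Iq].
  have := IJ _ Sy; have := Jz n; have := Jz m; rewrite /J.
  move: (\int[P]_w q (z m) w) (\int[P]_w q (z n) w) (\int[P]_w q y w).
  move: (\int[P]_w (q (z n) w - q (z m) w) ^+ 2) n.+1%:R^-1 m.+1%:R^-1.
  clear; move: I => I' A x y' B C D; lra.
have qC : forall c : R, 0 < c -> exists N, forall n m, (N <= n)%N ->
  (N <= m)%N ->
    (P [set w | c <= `|q (z n) w - q (z m) w|]%R < c%:E)%E.
  move=> c c0; have c30 : 0 < c ^+ 3 / 4 by rewrite divr_gt0// exprn_gt0.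
  have [N NP] := natSinv_lt c30; exists N => n m /NP nN /NP mN.
  have Id : P.-integrable setT (EFin \o (fun w => (q (z n) w - q (z m) w) ^+
    2)).
    apply: (@integrable_bounded _ _ _ _ _ 1).
      by apply: measurable_funX; apply: measurable_funB; exact: (mq _).
    move=> w; rewrite ger0_norm ?sqr_ge0//.
    have := q0 _ w (Sz n); have := q0 _ w (Sz m).
    have := q1 _ w (Sz n); have := q1 _ w (Sz m); nra.
  have -> : [set w | c <= `|q (z n) w - q (z m) w|] =
      [set w | c ^+ 2 <= (q (z n) w - q (z m) w) ^+ 2].
    apply/seteqP; split=> w /=; rewrite -[_ ^+ 2 <= _]ler_sqrt ?sqr_ge0//;
    by rewrite !sqrtr_sqr (gtr0_norm c0).
  have c20 : 0 < c ^+ 2 by exact: exprn_gt0.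
  apply: le_lt_trans (markov_Rintegral Id (fun w => sqr_ge0 _) c20) _.
  rewrite lte_fin ltr_pdivrMr//; apply: le_lt_trans (qL2 n m) _.
  rewrite -exprS; move: nN mN; move: n.+1%:R^-1 m.+1%:R^-1 (c ^+ 3) => A B C.
  by lra.
pose Q n : {mfun T >-> R} :=
  HB.pack (q (z n)) (isMeasurableFun.Build _ _ _ _ _ (mq _ (Sz n))).
have [q' q'P] := @cauchy_in_probability_cvg _ _ _ P Q qC.
pose r w := Num.max 0 (Num.min 1 (q' w)).
have r01 w : 0 <= r w <= 1.
  by rewrite /r le_max lexx/= ge_max ler01 ge_min lexx.
have mr : measurable_fun setT r.
  by apply: measurable_maxr => //; exact: measurable_minr.
have qr n w : `|q (z n) w - r w| <= `|q (z n) w - q' w|.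
  by apply: dist_clip01; rewrite q1//= ltW ?q0.
exists (fun w => r w ^+ 2); split.
- exact: measurable_funX.
- by move=> w; have /andP[r0 r1] := r01 w; rewrite sqr_ge0 expr_le1.
(* Where [z N < e], the hypothesis [a * e <= 1] gives [q (z N) > 1/2]; if moreover [q (z N)] is
   within [1/4] of its limit, then [r > 1/4] and [r ^+ 2 > 1/16]. Each of the two exceptional events
   has probability at most [e]. *)
- have c0 : 0 < Num.min e 4^-1 by rewrite lt_min e0 invr_gt0 ltr0n.
  have [N /(_ N (leqnn N)) PN] := q'P _ c0.
  have mz : measurable_fun setT (z N) by have [[] ] := Sz N.
  have mze := measurable_set_ge e mz.
  have mqq := @measurable_ge_dist _ _ _ (Q N) q' (Num.min e 4^-1).
  apply: (@le_trans _ _ (P ([set w | e <= z N w] `|`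
      [set w | Num.min e 4^-1 <= `|Q N w - q' w|]))).
    apply: le_measure; rewrite ?inE.
    - by apply: measurable_set_lt; exact: measurable_funX.
    - exact: measurableU.
    move=> w /= rw; have [|zw] := leP e (z N w); [by left|right].
    apply: le_trans (qr N w); rewrite ge_min; apply/orP; right.
    have r4 : r w < 4^-1.
      have /andP[r0 r1] := r01 w; rewrite ltNge; apply/negP => r4; move: rw.
      by apply/negP; rewrite -leNgt; nra.
    have q2 : 2^-1 < q (z N) w.
      rewrite /q ltf_pV2 ?posrE//;
        last exact: lt_le_trans ltr01 (u1 _ w (Sz N)).
      have : a * z N w < a * e by rewrite ltr_pM2l.
      lra.
    by apply: le_trans (ler_norm _); lra.
  apply: le_trans (measureU2 _ mze mqq) _.
  rewrite mulr2n mulrDl mul1r EFinD; apply: leeD; last first.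
    by rewrite (le_trans (ltW PN))// lee_fin ge_min lexx.
  have [[_ [X WX Xz]] _] := Sz N; apply: le_trans (ltW (We _ WX)).
  apply: le_measure_ae => //.
    apply: measurable_set_ge; apply: measurableT_comp => //.
  by apply: filterS Xz => w Xzw /= /le_trans; apply; rewrite Xzw ler_norm.
move=> Z WZ IZ.
have Irb (b : T -> R) (V : R) : measurable_fun setT b ->
  (forall w, 0 <= b w <= V) ->
    P.-integrable setT (EFin \o (fun w => b w * r w ^+ 2)).
  move=> mb bV; apply: (@integrable_bounded _ _ _ _ _ V).
    by apply: measurable_funM => //; exact: measurable_funX.
  move=> w; have /andP[b0 bV'] := bV w; have /andP[r0 r1] := r01 w.
  by rewrite ger0_norm ?mulr_ge0 ?sqr_ge0// -[leRHS]mulr1 ler_pM ?sqr_ge0//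
    expr_le1.
(* Truncation stays in [W] by solidity and supplies the upper bound [V] that [inv_secant] asks for;
   it is removed at the end by Fatou. *)
have key (k : nat) : a * \int[P]_w (r w ^+ 2 * Num.min `|Z w| k%:R) <= 1.
  pose y w := Num.min `|Z w| k%:R.
  have Sy : S y.
    split; last by move=> w; rewrite /y le_min normr_ge0/=.
    apply: (represented_solid sW (represented_L0 WZ)).
      by apply: measurable_minr => //; apply: measurableT_comp.
    by move=> w; rewrite ger0_norm /y ?le_min ?normr_ge0//= ge_min lexx.
  have my : measurable_fun setT y by have [[]] := Sy.
  pose v w := 1 + a * y w.
  have mv : measurable_fun setT v by apply: measurable_funD => //;
    exact: measurable_funM.
  pose V := 1 + a * k%:R.
  have vV w : 1 <= v w <= V.
    by rewrite u1//= lerD2l ler_pM2l// ge_min lexx orbT.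
  have V1 : 1 <= V by rewrite lerDl mulr_ge0// ltW.
  have Iv : P.-integrable setT (EFin \o (fun w => v w * r w ^+ 2)).
    by apply: (Irb _ V) => // w; have /andP[v1 ->] := vV w;
      rewrite (le_trans ler01 v1).
  apply: (@le_trans _ _ (\int[P]_w (v w * r w ^+ 2))).
    rewrite -RintegralZl//; last first.
      rewrite (_ : _ \o _ = EFin \o (fun w => y w * r w ^+ 2)).
        by apply: (Irb _ k%:R) => // w;
          rewrite /y le_min normr_ge0 ler0n/= ge_min lexx orbT.
      by apply/funext => w /=; rewrite mulrC.
    apply: le_Rintegral => //.
      apply: integrableZ_EFin.
      rewrite (_ : _ \o _ = EFin \o (fun w => y w * r w ^+ 2)).
        by apply: (Irb _ k%:R) => // w;
          rewrite /y le_min normr_ge0 ler0n/= ge_min lexx orbT.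
      by apply/funext => w /=; rewrite mulrC.
    by move=> w _; rewrite mulrCA mulrC ler_wpM2r ?sqr_ge0// /v lerDr.
  (* One factor [1 + th] comes from the near-minimality of [z n], the other from
     [1 + t * V <= 1 + th], and the last [th] from replacing [q (z n)] by its limit [r]. The step
     [t] is fixed before [n], because the minimisation error must be below [t * th]. *)
  have bnd th : 0 < th ->
    \int[P]_w (v w * r w ^+ 2) <= (1 + th) * (1 + th) + th.
    move=> th0; have V0 : 0 < V := lt_le_trans ltr01 V1.
    pose t := Num.min 2^-1 (th / V).
    have t0 : 0 < t by rewrite lt_min invr_gt0 ltr0n divr_gt0.
    have t1 : t < 1 by rewrite gt_min invf_lt1 ?ltr1n// ltr0n.
    have tV : t * V <= th by rewrite -ler_pdivlMr// ge_min lexx orbT.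
    have tth0 : 0 < t * th by exact: mulr_gt0.
    have c0 : 0 < th / (4 * V) by rewrite divr_gt0// mulr_gt0.
    have [N1 N1P] := natSinv_lt tth0; have [N2 N2P] := q'P _ c0.
    pose n := maxn N1 N2.
    have nt : n.+1%:R^-1 < t * th by apply: N1P; exact: leq_maxl.
    have Iqr : P.-integrable setT (EFin \o (fun w => `|q (z n) w - r w|)).
      apply: (@integrable_bounded _ _ _ _ _ 1).
        by apply: measurableT_comp => //; apply: measurable_funB => //;
          exact: (mq _).
      move=> w; rewrite normr_id; have /andP[? ?] := r01 w.
      have ? := q0 _ w (Sz n); have ? := q1 _ w (Sz n).
      by rewrite ler_norml; apply/andP; split; lra.
    have qrn : \int[P]_w `|q (z n) w - r w| <= 2 * (th / (4 * V)).
      apply: Rintegral_dist_le => //; [exact: (mq _)|exact: ltW| |].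
        move=> w; have /andP[? ?] := r01 w.
        have ? := q0 _ w (Sz n); have ? := q1 _ w (Sz n).
        by rewrite ler_norml; apply/andP; split; lra.
      apply: le_trans (ltW (N2P n (leq_maxr _ _))); apply: le_measure_ae.
      - apply: measurable_set_ge; apply: measurableT_comp => //.
        by apply: measurable_funB => //; exact: (mq _).
      - exact: (@measurable_ge_dist _ _ _ (Q n) q').
      by apply: aeW => w /= h; exact: le_trans (qr n w).
    have Ivq : P.-integrable setT (EFin \o (fun w => v w * q (z n) w ^+ 2)).
      apply: (@integrable_bounded _ _ _ _ _ V).
        by apply: measurable_funM => //; apply: measurable_funX; exact: (mq _).
      move=> w; have /andP[v1 vV'] := vV w; have q0' := q0 _ w (Sz n).
      have v0 : 0 <= v w := le_trans ler01 v1.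
      rewrite ger0_norm; last by rewrite mulr_ge0 ?sqr_ge0.
      rewrite -[leRHS]mulr1; apply: ler_pM => //; first exact: sqr_ge0.
      by rewrite expr_le1 ?q1// ltW.
    have vq : \int[P]_w (v w * q (z n) w ^+ 2) <= (1 + th) * (1 + th).
      pose x w := (1 - t) * z n w + t * y w.
      have Sx : S x by apply: Scomb => //; exact: ltW.
      have : \int[P]_w (q x w + t / (1 + t * V) * (v w * q (z n) w ^+ 2)) <=
          \int[P]_w (q (z n) w + t).
        apply: le_Rintegral => //.
        - by apply: integrableD_EFin; [exact: Iq|exact: integrableZ_EFin].
        - apply: integrableD_EFin; first exact: Iq.
          exact: finite_measure_integrable_cst.
        move=> w _; have /andP[v1 vV'] := vV w.
        apply: le_trans (inv_secant (u1 _ w (Sz n)) v1 vV' t0 t1).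
        rewrite lerD2r /q /x /v le_eqVlt; apply/orP; left; apply/eqP.
        by congr (_^-1); ring.
      rewrite RintegralD//; [|exact: Iq|exact: integrableZ_EFin].
      rewrite RintegralD//; [|exact: Iq|exact: finite_measure_integrable_cst].
      rewrite RintegralZl// Rintegral_probability_cst.
      move: (IJ _ Sx) (Jz n) nt; rewrite /J.
      move: (\int[P]_w q x w) (\int[P]_w q (z n) w).
      move: (\int[P]_w (v w * q (z n) w ^+ 2)) n.+1%:R^-1 => E A B C BI CI At.
      have tV0 : 0 < 1 + t * V by rewrite addr_gt0// mulr_gt0.
      rewrite mulrAC => h.
      have {h} : t * E / (1 + t * V) <= t * (1 + th) by lra.
      rewrite ler_pdivrMr// -mulrA ler_pM2l// => /le_trans; apply.
      by rewrite ler_pM2l ?lerD2l// addr_gt0.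
    apply: (@le_trans _ _ (\int[P]_w (v w * q (z n) w ^+ 2 +
        2 * V * `|q (z n) w - r w|))).
      apply: le_Rintegral => //.
        by apply: integrableD_EFin => //; exact: integrableZ_EFin.
      move=> w _; have /andP[v1 vV'] := vV w; have /andP[r0 r1] := r01 w.
      have qw0 := q0 _ w (Sz n); have qw1 := q1 _ w (Sz n).
      rewrite -lerBlDl -mulrBr.
      apply: (@le_trans _ _ (v w * (2 * `|q (z n) w - r w|))); last first.
        by rewrite mulrCA mulrA ler_wpM2r// ler_pM2l.
      rewrite ler_pM2l ?(lt_le_trans ltr01)//.
      have := ler_norm (r w - q (z n) w); rewrite distrC.
      have := normr_ge0 (q (z n) w - r w).
      move: (q (z n) w) (r w) `|_| r0 r1 qw0 qw1 => A B C; nra.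
    rewrite RintegralD//; last exact: integrableZ_EFin.
    rewrite RintegralZl//; apply: lerD => //.
    apply: le_trans (_ : 2 * V * (2 * (th / (4 * V))) <= _).
      by rewrite ler_pM2l// mulr_gt0.
    by rewrite le_eqVlt; apply/orP; left; apply/eqP; field; rewrite gt_eqF.
  apply/ler_addgt0Pr => th th0.
  (* For [th' <= 1], [(1 + th') * (1 + th') + th' <= 1 + 4 * th']. *)
  pose th' := Num.min 1 (th / 4).
  have th'0 : 0 < th' by rewrite lt_min ltr01 divr_gt0.
  have th'1 : th' <= 1 by rewrite ge_min lexx.
  have th'2 : th' <= th / 4 by rewrite ge_min lexx orbT.
  apply: le_trans (bnd _ th'0) _; nra.
have mr2 : measurable_fun setT (fun w => r w ^+ 2) by exact: measurable_funX.
have mZ : measurable_fun setT (fun w => `|Z w|) by apply: measurableT_comp.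
have IZr (b : T -> R) : measurable_fun setT b ->
  (forall w, 0 <= b w <= `|Z w|) ->
    P.-integrable setT (EFin \o (fun w => r w ^+ 2 * b w)).
  move=> mb bZ; apply: (integrable_dominated _ (integrable_norm_EFin IZ)).
    exact: measurable_funM.
  apply: aeW => w; have /andP[b0 bZw] := bZ w; have /andP[r0 r1] := r01 w.
  rewrite ger0_norm ?mulr_ge0 ?sqr_ge0//; apply: le_trans bZw.
  by rewrite ler_piMl// expr_le1.
rewrite -lee_fin EFin_Rintegral; last by apply: IZr => // w;
  rewrite normr_ge0 /=.
apply: (@integral_le_cvg _ _ _ P (fun k w => r w ^+ 2 * Num.min `|Z w| k%:R)).
- move=> k; apply: measurable_funM; first exact: measurable_funX.
  by apply: measurable_minr => //; apply: measurableT_comp.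
- by move=> k w; rewrite mulr_ge0 ?sqr_ge0// le_min normr_ge0/=.
- move=> w; apply: cvgMr; apply: cvg_near_cst.
  exists (Num.bound `|Z w|) => // k /= Nk; rewrite min_l//.
  apply: le_trans (ltW (Num.Theory.archi_boundP (normr_ge0 _))) _.
  by rewrite ler_nat.
- move=> k; rewrite -EFin_Rintegral ?lee_fin.
    by rewrite -[leRHS]mul1r ler_pdivlMr// mulrC.
  apply: IZr; first exact: measurable_minr.
  by move=> w; rewrite le_min normr_ge0 ler0n/= ge_min lexx.
Qed.
End solid_sets.

(** * From local convex-solidity to a single weight *)

Section weight.
Context d (T : measurableType d) (R : realType) (P : probability T R).
Implicit Types (X Y Z : L0 P) (A K W : set (L0 P)).

Lemma integrable_dist X Y : P.-integrable setT (EFin \o X) ->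
  P.-integrable setT (EFin \o Y) ->
  P.-integrable setT (EFin \o (fun w => `|Y w - X w|)).
Proof.
move=> IX IY; apply: integrable_norm_EFin.
exact: (@integrableB _ _ _ P setT measurableT (EFin \o Y) (EFin \o X)).
Qed.

Lemma Rintegral_dist_norm X Y (c : R) : P.-integrable setT (EFin \o X) ->
  P.-integrable setT (EFin \o Y) -> \int[P]_w `|X w| <= c ->
  \int[P]_w `|Y w| <= c -> \int[P]_w `|Y w - X w| <= 2 * c.
Proof.
move=> IX IY Xc Yc.
apply: (@le_trans _ _ (\int[P]_w (`|Y w| + `|X w|))).
  apply: le_Rintegral => //; first exact: integrable_dist.
    by apply: integrableD_EFin; exact: integrable_norm_EFin.
  by move=> w _; exact: ler_normB.
rewrite RintegralD//;
  [|exact: integrable_norm_EFin|exact: integrable_norm_EFin].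
by rewrite mulr2n mulrDl mul1r; exact: lerD.
Qed.

Lemma nbhs_L0_subspace A X (S : set (L0 P)) : A X ->
  nbhs (X : subspace A) S <->
  exists2 r : R, 0 < r & forall Y, A Y -> ball X r Y -> S Y.
Proof.
move=> AX; change (@nbhs_subspace _ A X S <-> exists2 r : R, 0 < r &
  forall Y, A Y -> ball X r Y -> S Y); rewrite -(nbhs_subspace_in AX); split.
  by move=> /nbhs_ballP[r r0 rS]; exists r => // Y AY /rS; exact.
by move=> [r r0 rS]; apply/nbhs_ballP; exists r => // Y XY AY; exact: rS.
Qed.

(** [W] is obtained before any [X] is named, and near [X] every point of [A] differs from [X] by an
    element of [W]; hence one density works at all points of [A]. *)
Lemma convex_solid_weight A (k : nat) :
  uniformly_locally_convex_solid A A -> A !=set0 ->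
  exists g : T -> R, [/\ measurable_fun setT g, forall w, 0 <= g w <= 1,
    (P [set w | g w < 16^-1]%R <= (2 * 2^-1 ^+ k)%:E)%E &
    forall X, A X -> exists2 r : R, 0 < r & forall Y, A Y -> ball X r Y ->
      P.-integrable setT (EFin \o X) -> P.-integrable setT (EFin \o Y) ->
      \int[P]_w (g w * `|Y w - X w|) <= k.+1%:R^-1].
Proof.
move=> lcs [X0 AX0].
have e0 : 0 < 2^-1 ^+ k :> R by rewrite exprn_gt0// invr_gt0.
have [W [csW WU AW]] := lcs _ (nbhsx_ballx (0 : L0 P) _ e0).
have W0 : W 0.
  have /nbhs_singleton[[Z WZ X0Z] _] := AW _ AX0.
  have <- // : Z = 0 by apply: (addrI X0); rewrite X0Z addr0.
have zeroE : {ae P, forall w, (0 : L0 P) w = 0} by exact: L0_classK.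
have We Z : W Z -> (P [set w | 2^-1 ^+ k <= `|Z w|]%R < (2^-1 ^+ k)%:E)%E.
  move=> /WU; apply: le_lt_trans; apply: le_measure_ae.
  - by apply: measurable_set_ge; apply: measurableT_comp.
  - exact: measurable_ge_dist.
  - by apply: filterS zeroE => w zw /=; rewrite zw sub0r normrN.
(* [solid_density] is used with [a = k + 1] and [e = 2^-k]: the bounds [a^-1] tend to 0, the
   exceptional probabilities are summable, and [a * e <= 1] holds because [k < 2^k]. *)
have ke1 : k.+1%:R * 2^-1 ^+ k <= 1 :> R.
  by rewrite exprVn ler_pdivrMr ?exprn_gt0// mul1r -natrX ler_nat;
    exact: ltn_expl.
have [g [mg g01 Pg Wg]] := solid_density csW W0 (ltr0Sn R k) e0 ke1 We.
  exists g; split=> // X AX.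
  have /(nbhs_L0_subspace _ AX)[r r0 rW] := AW _ AX;
    exists r => // Y AY XY IX IY.
  have [[Z WZ YXZ] _] := rW _ AY XY.
  have Zae : {ae P, forall w, Y w - X w = Z w}.
    by rewrite -YXZ; apply: filterS (L0_addE X Z) => w ->;
      rewrite addrAC subrr add0r.
  have IZ : P.-integrable setT (EFin \o Z).
    apply: (integrable_dominated _ (integrable_dist IX IY)) => //.
    by apply: filterS Zae => w ->.
  have Ig f : P.-integrable setT (EFin \o f) ->
      P.-integrable setT (EFin \o (fun w => g w * `|f w|)).
    move=> If; apply: (integrable_dominated _ (integrable_norm_EFin If)).
      apply: measurable_funM => //; apply: measurableT_comp => //.
      exact: integrable_measurable If.
    apply: aeW => w; have /andP[g0 g1] := g01 w.
    by rewrite ger0_norm ?mulr_ge0// ler_piMl.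
  apply: le_trans (Wg _ WZ IZ); apply: le_Rintegral_ae.
  - apply: Ig.
    exact: (@integrableB _ _ _ P setT measurableT (EFin \o Y) (EFin \o X)).
  - exact: Ig.
  - by apply: filterS Zae => w ->.
Qed.

Lemma uniformly_locally_convex_solid_weight A (C : R) :
  uniformly_locally_convex_solid A A -> A !=set0 ->
  (forall X, A X -> P.-integrable setT (EFin \o X)) ->
  (forall X, A X -> \int[P]_w `|X w| <= C) ->
  exists h : T -> R, [/\ measurable_fun setT h, forall w, 0 <= h w <= 1,
    {ae P, forall w, 0 < h w} &
    forall X (e : R), A X -> 0 < e -> exists2 r : R, 0 < r &
      forall Y, A Y -> ball X r Y -> \int[P]_w (h w * `|Y w - X w|) <= e].
Proof.
move=> lcs A0 IA AC.
have /choice[g gP] := fun k => convex_solid_weight k lcs A0.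
have mg k : measurable_fun setT (g k) by case: (gP k).
have g01 k w : 0 <= g k w <= 1 by case: (gP k).
(* The summand [k.+1%:R^-1] keeps [u k w] positive where [g k w] vanishes, which a.e. happens for
   finitely many [k] only; halving keeps [u 0], and with it the infimum, at most 1. *)
pose u k w := (g k w + k.+1%:R^-1) / 2.
have ki k : 0 < k.+1%:R^-1 :> R by rewrite invr_gt0.
have u0 k w : 0 < u k w.
  by have /andP[g0 _] := g01 k w; rewrite divr_gt0// ltr_wpDl.
(* [h] is below every [(g_k + 1 / (k + 1)) / 2], hence uses all neighbourhoods
   at once, and is positive where [g_k] stays away from 0 eventually. *)
pose h w := inf (range (u^~ w)).
have lbu w : has_lbound (range (u^~ w)) by exists 0 => _ [k _ <-]; exact: ltW.
have hu k w : h w <= u k w by apply: ge_inf => //; exists k.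
have h0 w : 0 <= h w.
  by apply: lb_le_inf; [exists (u 0%N w), 0%N|move=> _ [k _ <-]; exact: ltW].
have mh : measurable_fun setT h.
  rewrite (_ : h = fun w => infs (u^~ w) 0).
    apply: measurable_fun_infs => // k.
    by apply: measurable_funM => //; exact: measurable_funD.
  apply/funext => w; congr inf; apply/seteqP; split => [_ [k _ <-]|_ [k _ <-]];
  by exists k.
exists h; split => //.
- move=> w; rewrite h0 (le_trans (hu 0%N w))//= /u invr1.
  by have /andP[] := g01 0%N w; lra.
- pose B k := [set w | g k w < 16^-1].
  have mB k : measurable (B k) by exact: measurable_set_lt.
  have PB : P (lim_sup_set B) = 0%E.
    by apply: (@borel_cantelli_geometric _ _ _ _ _ 2) => // k; case: (gP k).
  exists (lim_sup_set B); split => //.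
    by apply: bigcap_measurable => // k _; exact: bigcup_measurable.
  move=> w; apply: contra_notP => /existsNP[n /not_implyP[_ nB]].
  (* For [k >= n] the bound [g k w >= 1/16] gives [u k w >= 1/32]; for [k < n] the summand
     [k.+1%:R^-1] takes over. *)
  have c0 : 0 < Num.min 32^-1 (n.+1%:R^-1 / 2) :> R.
    by rewrite lt_min invr_gt0 ltr0n divr_gt0.
  apply: lt_le_trans c0 _; apply: lb_le_inf; first by exists (u 0%N w), 0%N.
  move=> _ [k _ <-]; have /andP[g0 _] := g01 k w; have := ki k => ki0.
  have [nk|kn] := leqP n k.
    rewrite ge_min; apply/orP; left; rewrite /u.
    have : 16^-1 <= g k w by rewrite leNgt; apply/negP => gk; apply: nB;
      exists k.
    by move: (k.+1%:R^-1) (g k w) ki0 => c x; lra.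
  rewrite ge_min; apply/orP; right; rewrite /u ler_pM2r ?invr_gt0//.
  have : n.+1%:R^-1 <= k.+1%:R^-1 :> R by rewrite lef_pV2 ?posrE// ler_nat ltnW.
  by move=> /le_trans; apply; rewrite lerDr.
move=> X e AX e0.
have C0 : 0 <= C by apply: le_trans (AC _ AX); exact: Rintegral_ge0.
(* Bounding the weight by [u k] leaves [(1 + 2 * C) / 2] times [k.+1%:R^-1], where [2 * C] bounds
   the mean distance of two points of [A]. *)
have e' : 0 < 2 * e / (1 + 2 * C).
  by rewrite divr_gt0 ?mulr_gt0// ltr_wpDr// mulr_ge0.
have [k /(_ k (leqnn _)) kP] := natSinv_lt e'.
have [_ _ _ /(_ _ AX)[r r0 rP]] := gP k.
exists r => // Y AY XY; have IXY := integrable_dist (IA _ AX) (IA _ AY).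
have Ig (f : T -> R) : measurable_fun setT f -> (forall w, 0 <= f w <= 1) ->
    P.-integrable setT (EFin \o (fun w => f w * `|Y w - X w|)).
  move=> mf f01; apply: (integrable_dominated _ IXY).
    by apply: measurable_funM => //; exact: integrable_measurable IXY.
  apply: aeW => w; have /andP[f0 f1] := f01 w.
  by rewrite ger0_norm ?mulr_ge0// ler_piMl.
apply: (@le_trans _ _ (\int[P]_w
    (2^-1 * (g k w * `|Y w - X w| + k.+1%:R^-1 * `|Y w - X w|)))).
  apply: le_Rintegral => //.
  - apply: Ig => // w; rewrite h0 (le_trans (hu 0%N w))//= /u invr1.
    by have /andP[] := g01 0%N w; lra.
  - by apply: integrableZ_EFin; apply: integrableD_EFin;
      [exact: Ig|exact: integrableZ_EFin].
  move=> w _; rewrite -mulrDl mulrA ler_wpM2r// mulrC.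
  exact: hu.
have IgY : P.-integrable setT (EFin \o (fun w => g k w * `|Y w - X w|)) by
  exact: Ig.
rewrite RintegralZl//; last by apply: integrableD_EFin => //;
  exact: integrableZ_EFin.
rewrite RintegralD//; last exact: integrableZ_EFin.
rewrite RintegralZl//.
have := rP _ AY XY (IA _ AX) (IA _ AY).
have := Rintegral_dist_norm (IA _ AX) (IA _ AY) (AC _ AX) (AC _ AY).
move: kP (ki k); rewrite ltr_pdivlMr ?ltr_wpDr ?mulr_ge0//.
move: (k.+1%:R^-1) (\int[P]_w `|Y w - X w|) (\int[P]_w (g k w * _)) => a b c.
by clear => *; nra.
Qed.

End weight.

(** * Convex compactness and the gliding hump *)

Section convex_compactness.
Context d (T : measurableType d) (R : realType) (P : probability T R).
Implicit Types (X Y Z : L0 P).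

(** Strictly convex, yet within 1 of [|x|], so that its mean is controlled by the L1 bound. *)
Let phi (x : R) : R := Num.sqrt (1 + x ^+ 2).

Let phi_sqr x : phi x ^+ 2 = 1 + x ^+ 2.
Proof. by rewrite /phi sqr_sqrtr// addr_ge0// sqr_ge0. Qed.

Let phi_ge1 x : 1 <= phi x.
Proof. by rewrite -sqrtr1 /phi ler_wsqrtr// lerDl sqr_ge0. Qed.

Let phi_le x : phi x <= 1 + `|x|.
Proof.
have h := phi_sqr x; have h1 := phi_ge1 x; have h2 := normr_ge0 x.
rewrite leNgt; apply/negP => xp.
by have := real_normK (num_real x); nra.
Qed.

Let norm_le_phi x : `|x| <= phi x.
Proof.
have h := phi_sqr x; have h1 := phi_ge1 x; have h2 := normr_ge0 x.
rewrite leNgt; apply/negP => xp.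
by have := real_normK (num_real x); nra.
Qed.

(** [phi x] is the Euclidean norm of the vector [(1, x)]: this is the triangle inequality, and [xy]
    is Cauchy-Schwarz. *)
Let phi_mid x y : 2 * phi ((x + y) / 2) <= phi x + phi y.
Proof.
have hx := phi_sqr x; have hy := phi_sqr y; have hz := phi_sqr ((x + y) / 2).
have x1 := phi_ge1 x; have y1 := phi_ge1 y; have z1 := phi_ge1 ((x + y) / 2).
have xy : 1 + x * y <= phi x * phi y.
  rewrite leNgt; apply/negP => xy.
  have r0 : 0 <= phi x * phi y by rewrite mulr_ge0// (le_trans ler01).
  have h : (phi x * phi y) ^+ 2 < (1 + x * y) ^+ 2.
    by rewrite ltr_pXn2r ?nnegrE// (le_trans r0)// ltW.
  by move: h; rewrite exprMn hx hy; have := sqr_ge0 (x - y); nra.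
rewrite -ler_sqr ?nnegrE; [|lra|lra].
have -> : (phi x + phi y) ^+ 2 = phi x ^+ 2 + 2 * (phi x * phi y) + phi y ^+ 2.
  by ring.
by rewrite exprMn hz hx hy; lra.
Qed.

(** Two differences of squares link the gap to [(x - y) ^+ 2]; their cofactors are at most [4 * M]
    and [2 * M ^+ 2]. The convexity of [phi] degenerates at infinity, hence the bound [M]. *)
Let phi_gap x y (M : R) : phi x <= M -> phi y <= M ->
  (x - y) ^+ 2 / (4 * M ^+ 3) <= phi x + phi y - 2 * phi ((x + y) / 2).
Proof.
move=> xM yM.
have hx := phi_sqr x; have hy := phi_sqr y; have hz := phi_sqr ((x + y) / 2).
have x1 := phi_ge1 x; have y1 := phi_ge1 y; have z1 := phi_ge1 ((x + y) / 2).
have xyz := phi_mid x y.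
have M1 : 1 <= M by exact: le_trans xM.
move: hx hy hz x1 y1 z1 xM yM xyz.
move: (phi x) (phi y) (phi ((x + y) / 2)) => r s m hx hy hz x1 y1 z1 xM yM xyz.
have rsE : (r * s - (1 + x * y)) * (r * s + (1 + x * y)) = (x - y) ^+ 2.
  by rewrite -subr_sqr exprMn hx hy; ring.
have rs_ge : 0 <= r * s - (1 + x * y).
  rewrite leNgt; apply/negP => h.
  have rs0 : 0 < r * s by nra.
  have : 0 < r * s + (1 + x * y) by lra.
  have := sqr_ge0 (x - y); nra.
have rsM : r * s + (1 + x * y) <= 2 * M ^+ 2.
  have : r * s <= M ^+ 2 by nra.
  lra.
have h1 : (x - y) ^+ 2 <= (r * s - (1 + x * y)) * (2 * M ^+ 2).
  by rewrite -rsE ler_wpM2l.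
have h2 : (r + s - 2 * m) * (r + s + 2 * m) = 2 * (r * s - (1 + x * y)).
  rewrite -subr_sqr exprMn hz.
  have -> : (r + s) ^+ 2 = r ^+ 2 + 2 * (r * s) + s ^+ 2 by ring.
  by rewrite hx hy; field.
have h3 : r + s + 2 * m <= 4 * M by lra.
have h4 : 2 * (r * s - (1 + x * y)) <= (r + s - 2 * m) * (4 * M).
  by rewrite -h2 ler_wpM2l// subr_ge0.
have M0 : 0 < M := lt_le_trans ltr01 M1.
rewrite ler_pdivrMr ?mulr_gt0 ?exprn_gt0//; apply: le_trans h1 _.
have M2 : 0 < M ^+ 2 by rewrite exprn_gt0// (lt_le_trans ltr01).
apply: (@le_trans _ _ ((r + s - 2 * m) * (2 * M) * (2 * M ^+ 2))).
  by rewrite ler_pM2r ?mulr_gt0//; lra.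
by rewrite le_eqVlt; apply/orP; left; apply/eqP; ring.
Qed.

(** The infima of the mean of [phi] over the decreasing sets [H n] increase to a finite supremum.
    Two late near-minimisers have their midpoint in an earlier [H N1] whose infimum is already close
    to that supremum, so their convexity gap is small in mean. *)
Lemma midpoint_closed_cauchy (H : nat -> set (L0 P)) (C : R) :
  (forall n, H n.+1 `<=` H n) -> (forall n, H n !=set0) ->
  (forall n X Y, H n X -> H n Y -> H n (2^-1 *: (X + Y))) ->
  (forall n X, H n X -> P.-integrable setT (EFin \o X)) ->
  (forall n X, H n X -> \int[P]_w `|X w| <= C) ->
  exists Y : nat -> L0 P, (forall n, H n (Y n)) /\
    forall e : R, 0 < e -> exists N, forall m n, (N <= m)%N -> (N <= n)%N ->
      (P [set w | e <= `|Y m w - Y n w|]%R < e%:E)%E.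
Proof.
move=> Hdecr H0 Hmid IH HC.
have mphi (f : T -> R) : measurable_fun setT f ->
    measurable_fun setT (fun w => phi (f w)).
  move=> mf.
  have /measurableT_comp : measurable_fun setT (@Num.sqrt R).
    exact: (continuous_measurable_fun (@sqrt_continuous R)).
  apply; apply: measurable_funD => //.
  exact: measurable_funX.
have Iphi X : P.-integrable setT (EFin \o X) ->
    P.-integrable setT (EFin \o (fun w => phi (X w))).
  move=> IX.
  have I1 : P.-integrable setT (EFin \o (fun w => 1 + `|X w|)).
    apply: integrableD_EFin; last exact: integrable_norm_EFin.
    exact: finite_measure_integrable_cst.
  apply: (integrable_dominated (mphi _ _) I1) => //.
  by apply: aeW => w; rewrite ger0_norm ?phi_le// (le_trans ler01 (phi_ge1 _)).
pose Phi X := \int[P]_w phi (X w).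
have Phi0 X : 0 <= Phi X.
  by apply: Rintegral_ge0 => w _; rewrite (le_trans ler01 (phi_ge1 _)).
have PhiC n X : H n X -> Phi X <= 1 + C.
  move=> HX; apply: (@le_trans _ _ (\int[P]_w (1 + `|X w|))).
    apply: le_Rintegral => //; first exact/Iphi/(IH n).
    apply: integrableD_EFin; last exact/integrable_norm_EFin/(IH n).
    exact: finite_measure_integrable_cst.
  rewrite RintegralD//; last 2 first.
    exact: finite_measure_integrable_cst.
    exact/integrable_norm_EFin/(IH n).
  by rewrite Rintegral_probability_cst lerD2l (HC n).
pose J n := inf (Phi @` H n).
have lbJ n : has_lbound (Phi @` H n) by exists 0 => _ [X _ <-].
have neJ n : Phi @` H n !=set0 by have [X HX] := H0 n; exists (Phi X), X.
have JPhi n X : H n X -> J n <= Phi X by move=> HX; apply: ge_inf => //;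
  exists X.
have Hle n m : (n <= m)%N -> H m `<=` H n.
  move=> nm; rewrite -(subnKC nm); elim: (m - n)%N => [|k IHk];
    rewrite ?addn0//.
  by rewrite addnS; apply: subset_trans IHk; exact: Hdecr.
have /choice[Y YP] : forall n, exists X, H n X /\ Phi X < J n + n.+1%:R^-1.
  move=> n; have n0 : 0 < n.+1%:R^-1 :> R by rewrite invr_gt0.
  have [_ [X HX <-] XJ] := inf_adherent n0 (conj (neJ n) (lbJ n)).
  by exists X.
have HY n : H n (Y n) by case: (YP n).
exists Y; split => // e e0.
have supJ : has_sup (range J).
  split; first by exists (J 0%N), 0%N.
  exists (1 + C) => _ [n _ <-]; have [X HX] := H0 n.
  exact: le_trans (JPhi _ _ HX) (PhiC _ _ HX).
pose S := sup (range J).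
have JS n : J n <= S by apply: ub_le_sup; [case: supJ|exists n].
have C1 : 0 < 1 + C.
  have [X HX] := H0 0%N; rewrite ltr_wpDr//.
  by apply: le_trans (HC _ _ HX); exact: Rintegral_ge0.
(* By Markov, [phi] exceeds [M] with probability at most [e / 8] for each of the two variables. The
   gap has mean at most [4 * del], and [del] is such that it exceeds [e ^+ 2 / (4 * M ^+ 3)] with
   probability at most [e / 4]. The total is [e / 2]. *)
pose M := 8 * (1 + C) / e.
have M0 : 0 < M by rewrite divr_gt0// mulr_gt0.
pose del := e ^+ 3 / (64 * M ^+ 3).
have del0 : 0 < del.
  by apply: divr_gt0; [exact: exprn_gt0|rewrite mulr_gt0// exprn_gt0].
have [_ [N1 _ <-] JN1] := sup_adherent del0 supJ.
have [N2 N2P] := natSinv_lt del0.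
exists (maxn N1 N2) => m n; rewrite !geq_max => /andP[m1 m2] /andP[n1 n2].
pose Z : L0 P := 2^-1 *: (Y m + Y n).
have HZ : H N1 Z by apply: Hmid; [apply: Hle (HY m)|apply: Hle (HY n)].
have [IYm IYn IZ] : [/\ P.-integrable setT (EFin \o Y m),
    P.-integrable setT (EFin \o Y n) & P.-integrable setT (EFin \o Z)].
  by split; [exact: (IH m)|exact: (IH n)|exact: (IH N1)].
have Zae : {ae P, forall w, Z w = (Y m w + Y n w) / 2}.
  apply: filterS2 (L0_scaleE 2^-1 (Y m + Y n)) (L0_addE (Y m) (Y n)) => w ZE YE.
  by rewrite /Z ZE YE mulrC.
pose G w := phi (Y m w) + phi (Y n w) - 2 * phi ((Y m w + Y n w) / 2).
have G0 w : 0 <= G w by rewrite /G subr_ge0 phi_mid.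
have IS : P.-integrable setT (EFin \o (fun w => phi (Y m w) + phi (Y n w))).
  by apply: integrableD_EFin; exact: Iphi.
have mG : measurable_fun setT G.
  apply: measurable_funB; first exact: integrable_measurable IS.
  apply: measurable_funM => //.
  by apply: mphi; apply: measurable_funM => //; exact: measurable_funD.
have IG : P.-integrable setT (EFin \o G).
  apply: (integrable_dominated mG IS); apply: aeW => w.
  by rewrite ger0_norm// /G gerBl mulr_ge0// (le_trans ler01 (phi_ge1 _)).
have GE : \int[P]_w G w <= 4 * del.
  apply: (@le_trans _ _ (\int[P]_w (phi (Y m w) + phi (Y n w) + -2 * phi (Z
    w)))).
    apply: le_Rintegral_ae => //.
      by apply: integrableD_EFin => //; apply: integrableZ_EFin; exact: Iphi.
    by apply: filterS Zae => w ZE; rewrite ZE mulNr.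
  rewrite RintegralD//; last by apply: integrableZ_EFin; exact: Iphi.
  rewrite RintegralD//; [|exact: Iphi|exact: Iphi].
  rewrite RintegralZl//; last exact: Iphi.
  have [_ hm] := YP m; have [_ hn] := YP n.
  have := N2P _ m2; have := N2P _ n2; have := JPhi _ _ HZ.
  have := JS m; have := JS n; move: JN1 hm hn; rewrite -/S /Phi.
  move: (\int[P]_w phi (Y m w)) (\int[P]_w phi (Y n w)) (\int[P]_w phi (Z w)).
  move: n.+1%:R^-1 m.+1%:R^-1 (J N1) (J m) (J n).
  by clear; move: S del => *; lra.
pose B X := [set w | M <= phi (X w)].
have mB X : measurable (B X) by apply: measurable_set_ge; exact: mphi.
have PB k X : H k X -> (P (B X) <= (e / 8)%:E)%E.
  move=> HX; apply: le_trans (markov_Rintegral (Iphi _ (IH _ _ HX)) _ M0) _.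
    by move=> w; rewrite (le_trans ler01 (phi_ge1 _)).
  rewrite lee_fin ler_pdivrMr//; apply: le_trans (PhiC _ _ HX) _.
  by rewrite /M le_eqVlt; apply/orP; left; apply/eqP; field; rewrite gt_eqF.
have c0 : 0 < e ^+ 2 / (4 * M ^+ 3).
  by apply: divr_gt0; [exact: exprn_gt0|rewrite mulr_gt0// exprn_gt0].
pose D := [set w | e ^+ 2 / (4 * M ^+ 3) <= G w].
have mD : measurable D by exact: measurable_set_ge.
have PD : (P D <= (e / 4)%:E)%E.
  apply: le_trans (markov_Rintegral IG G0 c0) _.
  rewrite lee_fin ler_pdivrMr//; apply: le_trans GE _.
  by rewrite /del le_eqVlt; apply/orP; left; apply/eqP; field; rewrite gt_eqF.
apply: (@le_lt_trans _ _ (P (B (Y m) `|` B (Y n) `|` D))).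
  apply: le_measure; rewrite ?inE.
  - exact: measurable_ge_dist.
  - by apply: measurableU => //; exact: measurableU.
  move=> w /= ew; have [?|mM] := leP M (phi (Y m w)); first by left; left.
  have [?|nM] := leP M (phi (Y n w)); first by left; right.
  right; apply: le_trans (phi_gap (ltW mM) (ltW nM)).
  rewrite ler_pM2r; last by rewrite invr_gt0 mulr_gt0// exprn_gt0.
  by rewrite -(real_normK (num_real (_ - _))) ler_pXn2r// ?nnegrE ltW.
apply: le_lt_trans (measureU2 _ _ mD) _; first exact: measurableU.
apply: (@le_lt_trans _ _ ((e / 8)%:E + (e / 8)%:E + (e / 4)%:E)%E).
  apply: leeD => //; apply: le_trans (measureU2 _ (mB _) (mB _)) _.
  by apply: leeD; [exact: (PB m)|exact: (PB n)].
rewrite -!EFinD lte_fin; lra.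
Qed.
End convex_compactness.

(** * Choice of the humps *)

Section gliding_hump.
Context d (T : measurableType d) (R : realType) (P : probability T R).
Implicit Types (X Y Z : L0 P) (K : set (L0 P)).

(** [c] is the infimum over [l] of the supremum of [F x l] over [K]: the upper bound holds at some
    level, the lower bound at every level. *)
Lemma limsup_witness (I : Type) (K : set I) (F : I -> R -> R) (C e : R) :
  0 < e -> (forall x l, K x -> F x l <= C) ->
  (forall l, exists x, K x /\ e < F x l) ->
  exists c, [/\ e <= c,
    forall del : R, 0 < del -> exists l, forall x, K x -> F x l <= c + del &
    forall (del : R) l, 0 < del -> exists x, K x /\ c - del < F x l].
Proof.
move=> e0 FC Fe; pose m l := sup (F^~ l @` K).
have sm l : has_sup (F^~ l @` K).
  have [x [Kx _]] := Fe l; split; first by exists (F x l), x.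
  by exists C => _ [y Ky <-]; exact: FC.
have em l : e <= m l.
  have [x [Kx eX]] := Fe l; apply: le_trans (ltW eX) _.
  by apply: ub_le_sup; [case: (sm l)|exists x].
have im : has_inf (range m) by split; [exists (m 0), 0|exists e => _ [l _ <-]].
exists (inf (range m)); split.
- by apply: lb_le_inf; [case: im|move=> _ [l _ <-]].
- move=> del del0; have [_ [l _ <-] lm] := inf_adherent del0 im.
  exists l => x Kx; apply: le_trans (ltW lm).
  by apply: ub_le_sup; [case: (sm l)|exists x].
- move=> del l del0; have [_ [x Kx <-] Xm] := sup_adherent del0 (sm l).
  exists x; split => //; apply: le_lt_trans Xm; rewrite lerD2r.
  by apply: ge_inf; [case: im|exists l].
Qed.

Definition tail_set (f : T -> R) (l : R) : set T := [set w | l < `|f w|].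

Lemma measurable_tail_set (f : T -> R) (l : R) : measurable_fun setT f ->
  measurable (tail_set f l).
Proof. by move=> mf; apply: measurable_set_gt; exact: measurableT_comp. Qed.

Lemma indic01 (A : set T) w : 0 <= (\1_A w : R) <= 1.
Proof. by rewrite indicE; case: (w \in A); rewrite /= ?lexx ler01. Qed.

Lemma integrableM01 (f b : T -> R) : P.-integrable setT (EFin \o f) ->
  measurable_fun setT b -> (forall w, 0 <= b w <= 1) ->
  P.-integrable setT (EFin \o (fun w => b w * f w)).
Proof.
move=> If mb b01; apply: (integrable_dominated _ (integrable_norm_EFin If)).
  by apply: measurable_funM => //; exact: integrable_measurable If.
apply: aeW => w; have /andP[b0 b1] := b01 w.
by rewrite normrM ger0_norm// ler_piMl.
Qed.

Lemma integrable_indicM (f : T -> R) (A : set T) :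
  P.-integrable setT (EFin \o f) -> measurable A ->
  P.-integrable setT (EFin \o (fun w => \1_A w * f w)).
Proof.
by move=> If mA; apply: integrableM01 => // w; exact: indic01.
Qed.

Lemma integrable_small_set (f : T -> R) (e : R) :
  P.-integrable setT (EFin \o f) -> 0 < e ->
  exists2 r : R, 0 < r & forall A, measurable A -> (P A < r%:E)%E ->
    \int[P]_w (\1_A w * `|f w|) < e.
Proof.
move=> If e0; have [r [r0 rP]] := integral_normr_continuous If e0.
exists r => // A mA PA; have := rP A mA PA; rewrite Rintegral_mkcond.
apply: le_lt_trans; rewrite le_eqVlt; apply/orP; left; apply/eqP.
by apply: eq_Rintegral => w _; rewrite patchE indicE; case: (w \in A);
  rewrite ?mul1r ?mul0r.
Qed.

Lemma prob_tail (X : L0 P) (C l : R) : P.-integrable setT (EFin \o X) ->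
  \int[P]_w `|X w| <= C -> 0 < l -> (P (tail_set X l) <= (C / l)%:E)%E.
Proof.
move=> IX XC l0.
have h := markov_Rintegral (integrable_norm_EFin IX) (fun w => normr_ge0 _) l0.
apply: (@le_trans _ _ (P [set w | l <= `|X w|])).
  apply: le_measure; rewrite ?inE.
  - exact: measurable_tail_set.
  - by apply: measurable_set_ge; apply: measurableT_comp.
  - by move=> w /= /ltW.
by apply: le_trans h _; rewrite lee_fin ler_pM2r ?invr_gt0.
Qed.

Variables (h : T -> R) (K : set (L0 P)) (C : R).
Hypothesis mh : measurable_fun setT h.
Hypothesis h01 : forall w, 0 <= h w <= 1.
Hypothesis IK : forall X, K X -> P.-integrable setT (EFin \o X).
Hypothesis KC : forall X, K X -> \int[P]_w `|X w| <= C.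

Definition weighted_tail (X : L0 P) (l : R) : R :=
  \int[P]_w (h w * (\1_(tail_set X l) w * `|X w|)).

Lemma integrable_weighted_tail X l : K X ->
  P.-integrable setT (EFin \o (fun w => h w * (\1_(tail_set X l) w * `|X w|))).
Proof.
move=> KX; apply: integrableM01 => //; apply: integrable_indicM.
  exact/integrable_norm_EFin/IK.
exact: measurable_tail_set.
Qed.

Lemma weighted_tail_le X l : K X -> weighted_tail X l <= C.
Proof.
move=> KX; apply: le_trans (KC KX); apply: le_Rintegral => //.
- exact: integrable_weighted_tail.
- exact/integrable_norm_EFin/IK.
move=> w _; have /andP[h0 h1] := h01 w;
  have /andP[i0 i1] := indic01 (tail_set X l) w.
by rewrite mulrA ler_piMl// mulr_ile1.
Qed.

(** By the L1 bound, high tail events are improbable uniformly over [K], so they carry little of the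
    single integrable function [G], in which the earlier humps are collected. *)
Lemma next_hump (G : T -> R) (k : nat) (c lhat : R) :
  P.-integrable setT (EFin \o G) -> (forall w, 0 <= G w) ->
  (forall l, exists X, K X /\ c < weighted_tail X l) ->
  exists X, exists l, [/\ K X, lhat <= l, c < weighted_tail X l &
    \int[P]_w (\1_(tail_set X l) w * G w) <= 2^-1 ^+ k].
Proof.
move=> IG G0 Kc.
have e0 : 0 < 2^-1 ^+ k :> R by rewrite exprn_gt0// invr_gt0.
have [r r0 rP] := integrable_small_set IG e0.
(* [(C + 1) / r] makes the Markov bound [C / l] strictly smaller than [r]; the 1 ensures [l > 0]. *)
pose l := Num.max lhat (Num.max 1 ((C + 1) / r)).
have [X [KX Xc]] := Kc l; exists X, l; split => //.
  by rewrite /l le_max lexx.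
have l1 : 1 <= l by rewrite /l !le_max lexx orbT.
have lC : (C + 1) / r <= l by rewrite /l !le_max lexx !orbT.
have l0 : 0 < l := lt_le_trans ltr01 l1.
under eq_Rintegral do rewrite -(ger0_norm (G0 _)).
apply: ltW; apply: rP; first exact: measurable_tail_set.
apply: le_lt_trans (prob_tail (IK KX) (KC KX) l0) _.
rewrite lte_fin ltr_pdivrMr// mulrC -ltr_pdivrMr//; apply: lt_le_trans lC.
by rewrite ltr_pM2r ?invr_gt0// ltrDl.
Qed.

Lemma hump_sequence (c lhat : R) :
  (forall l, exists X, K X /\ c < weighted_tail X l) ->
  exists X : nat -> L0 P, exists l : nat -> R, forall k,
    [/\ K (X k), lhat <= l k, c < weighted_tail (X k) (l k),
      \int[P]_w \1_(tail_set (X k) (l k)) w <= 2^-1 ^+ k &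
      forall j, (j < k)%N ->
        \int[P]_w (\1_(tail_set (X k) (l k)) w * `|X j w|) <= 2^-1 ^+ k].
Proof.
move=> Kc.
pose ok (G : T -> R) := P.-integrable setT (EFin \o G) /\ forall w, 0 <= G w.
(* Choice needs a total relation: pairs whose function is not [ok] get the value [(0, 0)], and [okG]
   shows that the recursion never meets them. *)
have /choice[s sP] : forall p : (T -> R) * nat, exists q : L0 P * R, ok p.1 ->
    [/\ K q.1, lhat <= q.2, c < weighted_tail q.1 q.2 &
    \int[P]_w (\1_(tail_set q.1 q.2) w * p.1 w) <= 2^-1 ^+ p.2].
  move=> [G k]; have [[IG G0]|nG] := pselect (ok G).
    by have [X [l Xl]] := next_hump k lhat IG G0 Kc; exists (X, l).
  by exists (0, 0).
(* [G k] is 1 plus the sum of [|X j|] for [j < k]. One integral bound thus controls both the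
   probability of the next tail event and the mass of every earlier hump on it. *)
pose G := fix G k := if k is k'.+1 then fun w => G k' w + `|(s (G k', k')).1 w|
  else cst 1.
have okG k : ok (G k).
  elim: k => [|k okGk].
    by split => //=; exact: finite_measure_integrable_cst.
  have [KX _ _ _] := sP (G k, k) okGk; case: okGk => IG G0.
  split; last by move=> w /=; rewrite addr_ge0.
  by apply: integrableD_EFin => //; exact/integrable_norm_EFin/IK.
pose X k := (s (G k, k)).1; pose l k := (s (G k, k)).2.
exists X, l => k; have [KX ll cX GX] := sP (G k, k) (okG k).
have mA : measurable (tail_set (X k) (l k)) by exact: measurable_tail_set.
have leG (f : T -> R) : P.-integrable setT (EFin \o f) ->
    (forall w, f w <= G k w) ->
    \int[P]_w (\1_(tail_set (X k) (l k)) w * f w) <= 2^-1 ^+ k.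
  move=> If fG; apply: le_trans GX; apply: le_Rintegral => //.
  - exact: integrable_indicM.
  - by apply: integrable_indicM => //; case: (okG k).
  by move=> w _; rewrite ler_wpM2l//;
    have /andP[] := indic01 (tail_set (X k) (l k)) w.
have G1 w : 1 <= G k w.
  elim: k {KX ll cX GX mA leG} => //= k IH; by apply: le_trans IH _;
    rewrite lerDl.
split => //.
- under eq_Rintegral do rewrite -[\1__ _]mulr1.
  by apply: (leG (cst 1)) => //; exact: finite_measure_integrable_cst.
- move=> j jk; apply: leG.
    by apply/integrable_norm_EFin/IK; have [] := sP (G j, j) (okG j).
  move=> w; elim: k jk {KX ll cX GX mA G1} => // k IH.
  rewrite ltnS leq_eqVlt => /orP[/eqP <-|/IH jk] /=.
    by rewrite lerDr; case: (okG j).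
  by apply: le_trans jk _; rewrite lerDl.
Qed.

End gliding_hump.

(** * A test function made of the signs of the humps *)

Section hump_sign.
Context d (T : measurableType d) (R : realType) (P : probability T R).
Variables (X : nat -> L0 P) (l : nat -> R).

Local Notation a k := (\1_(tail_set (X k) (l k)) : T -> R).
Let s k w : R := 2 * \1_[set w | 0 <= X k w] w - 1.

(* Equal to the sign of [X k] at the points where k is the last index
   in [n, n + m[ with [l k < |X k|], and to 0 if there is no such index. *)
Fixpoint hump_sign (n m : nat) (w : T) : R :=
  if m is m'.+1 then
    a (n + m')%N w * s (n + m')%N w + (1 - a (n + m')%N w) * hump_sign n m' w
  else 0.

Lemma tail_indicP k w : (a k w = 1 /\ l k < `|X k w|) \/
  (a k w = 0 /\ `|X k w| <= l k).
Proof.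
have [lX|Xl] := ltP (l k) `|X k w|; [left|right]; split => //.
  by rewrite indicE mem_set.
by rewrite indicE memNset//= => /(le_lt_trans Xl); rewrite ltxx.
Qed.

Let s_sign k w : s k w * X k w = `|X k w| /\ `|s k w| = 1.
Proof.
rewrite /s indicE; have [X0|X0] := leP 0 (X k w).
  rewrite mem_set//= (_ : 2 * 1 - 1 = 1 :> R); last lra.
  by rewrite mul1r normr1 ger0_norm.
rewrite memNset/=; last by apply/negP; rewrite -ltNge.
by rewrite mulr0 sub0r normrN1 mulN1r ltr0_norm.
Qed.

Lemma measurable_tail_indic k : measurable_fun setT (a k).
Proof. by apply: measurable_indic; exact: measurable_tail_set. Qed.

Lemma measurable_hump_sign n m : measurable_fun setT (hump_sign n m).
Proof.
elim: m => //= m IH; have ma := measurable_tail_indic.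
apply: measurable_funD; apply: measurable_funM => //.
  apply: measurable_funB => //; apply: measurable_funM => //.
  by apply: measurable_indic; exact: measurable_set_ge.
exact: measurable_funB.
Qed.

Lemma hump_sign_norm n m w : `|hump_sign n m w| = 0 \/ `|hump_sign n m w| = 1.
Proof.
elim: m => [|m IH] /=; first by left; rewrite normr0.
have [_ s1] := s_sign (n + m) w.
case: (tail_indicP (n + m) w) => -[-> _].
  by right; rewrite subrr mul0r addr0 mul1r.
by rewrite subr0 mul0r add0r mul1r.
Qed.

Lemma hump_sign_le1 n m w : `|hump_sign n m w| <= 1.
Proof. by case: (hump_sign_norm n m w) => ->. Qed.

Lemma hump_sign_le_sum n m w :
  `|hump_sign n m w| <= \sum_(i < m) a (n + i)%N w.
Proof.
elim: m => [|m IH] /=; first by rewrite big_ord0 normr0.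
rewrite big_ord_recr/=; have [_ s1] := s_sign (n + m) w.
case: (tail_indicP (n + m) w) => -[-> _]; last first.
  by rewrite subr0 mul0r add0r mul1r addr0.
by rewrite subrr mul0r addr0 mul1r s1 lerDr sumr_ge0.
Qed.

(** On its own tail set, [X j] meets its own sign unless a later hump overwrites it; there [|X j|]
    may become [- |X j|], hence the factor 2. Off that tail set only [|hump_sign| <= 1] on its
    support is known, which gives the last term. *)
Lemma hump_sign_lower n m j w : (n <= j)%N -> (j < n + m)%N ->
  a j w * `|X j w| -
    2 * \sum_(i < m) (if (j < n + i)%N then a (n + i)%N w * `|X j w| else 0) -
    (1 - a j w) * `|X j w| * `|hump_sign n m w| <= hump_sign n m w * X j w.
Proof.
move=> nj; elim: m => [|m IH]; first by rewrite addn0 ltnNge nj.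
have a0 k : 0 <= a k w by have /andP[] := indic01 R (tail_set (X k) (l k)) w.
have a1 k : a k w <= 1 by have /andP[] := indic01 R (tail_set (X k) (l k)) w.
have S0 : 0 <= \sum_(i < m) (if (j < n + i)%N then a (n + i)%N w * `|X j w|
  else 0).
  by apply: sumr_ge0 => i _; case: ifP => // _; exact: mulr_ge0.
have Xlow (x : R) : `|x| <= 1 -> - (`|X j w| * `|x|) <= x * X j w.
  by move=> _; rewrite lerNl (le_trans (ler_norm _))// normrN normrM mulrC.
rewrite addnS ltnS leq_eqVlt => /orP[/eqP jE|jm].
  rewrite big_ord_recr /= -jE ltnn addr0.
  have [sX s1] := s_sign j w.
  case: (tail_indicP j w) => -[-> _].
    by rewrite !(subrr, mul0r, addr0, mul1r, subr0) sX gerBl mulr_ge0.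
  rewrite !(subr0, mul0r, add0r, mul1r, sub0r).
  have := Xlow _ (hump_sign_le1 n m w); lra.
rewrite big_ord_recr /= jm; have := IH jm.
have [sX s1] := s_sign (n + m) w.
case: (tail_indicP (n + m) w) => -[-> _]; last first.
  by rewrite !(subr0, mul0r, add0r, mul1r, addr0).
move=> _; rewrite !(subrr, mul0r, addr0, mul1r) s1 mulr1.
have := Xlow (s (n + m)%N w); rewrite s1 mulr1 => /(_ (lexx _)).
have := a0 j; have := a1 j; have := normr_ge0 (X j w).
move: (s (n + m)%N w * X j w) (a j w) `|X j w| (\sum_(i < m) _) S0; clear.
move=> x b y S S0 y0 b1 b0 h; nra.
Qed.

(** The last term of [hump_sign_lower] is split at [lhat]: below it is at most [lhat] times the
    number of tail sets hit, above it is the part of [|X j|] between the levels [lhat] and [l j].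
    That part is a difference of two tails, whence the coefficients 2 and -1. The weight [c <= 1] is
    dropped from the nonnegative errors. *)
Lemma weighted_hump_sign_lower n m j w (c lhat : R) : (n <= j)%N ->
  (j < n + m)%N -> 0 <= c <= 1 -> 0 <= lhat -> lhat <= l j ->
  2 * (c * (a j w * `|X j w|)) +
    -1 * (c * (\1_(tail_set (X j) lhat) w * `|X j w|)) +
    (-2 * \sum_(i < m) (if (j < n + i)%N then a (n + i)%N w * `|X j w| else 0) +
    - lhat * \sum_(i < m) a (n + i)%N w) <= c * (hump_sign n m w * X j w).
Proof.
move=> nj jm /andP[c0 c1] l0 ll.
have low := hump_sign_lower w nj jm.
have F0 := normr_ge0 (hump_sign n m w).
have F1 := hump_sign_le1 n m w.
have FS := hump_sign_le_sum n m w.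
have S0 : 0 <= \sum_(i < m) (if (j < n + i)%N then a (n + i)%N w * `|X j w|
  else 0).
  by apply: sumr_ge0 => i _; case: ifP => // _; apply: mulr_ge0.
have x0 := normr_ge0 (X j w).
have key : (1 - a j w) * `|X j w| * `|hump_sign n m w| <=
    lhat * `|hump_sign n m w| +
    \1_(tail_set (X j) lhat) w * `|X j w| - a j w * `|X j w|.
  have [hX|hX] := ltP lhat `|X j w|.
    rewrite [\1_(tail_set _ lhat) w]indicE mem_set//=.
    by case: (tail_indicP j w) => -[-> _]; nra.
  rewrite [\1_(tail_set _ lhat) w]indicE memNset/=; last first.
    by move=> /(le_lt_trans hX); rewrite ltxx.
  case: (tail_indicP j w) => -[-> lX].
    by have := lt_le_trans lX (le_trans hX ll); rewrite ltxx.
  by nra.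
have lFS := ler_wpM2l l0 FS; have FS0 := le_trans F0 FS.
have lS0 := mulr_ge0 l0 FS0.
set S := \sum_(i < m) (if _ then _ else _) in S0 low *.
set B := 2 * S + lhat * \sum_(i < m) a (n + i)%N w.
have B0 : 0 <= B by rewrite addr_ge0// mulr_ge0.
apply: (@le_trans _ _ (c * (2 * (a j w * `|X j w|) -
    \1_(tail_set (X j) lhat) w * `|X j w| - B))); last first.
  by rewrite ler_wpM2l// /B; lra.
have cB : c * B <= B by rewrite ler_piMl.
rewrite !mulrBr /B in cB *; lra.
Qed.

End hump_sign.

Lemma Rintegral_sum_le d (T : measurableType d) (R : realType)
    (P : probability T R) (f : nat -> T -> R) (b : nat -> R) (m : nat) :
  (forall i, P.-integrable setT (EFin \o f i)) ->
  (forall i, \int[P]_w f i w <= b i) ->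
  P.-integrable setT (EFin \o (fun w => \sum_(i < m) f i w)) /\
  \int[P]_w (\sum_(i < m) f i w) <= \sum_(i < m) b i.
Proof.
move=> If fb; elim: m => [|m [IS Sb]].
  under [X in EFin \o X]eq_fun do rewrite big_ord0.
  under eq_Rintegral do rewrite big_ord0.
  rewrite big_ord0 Rintegral_probability_cst; split => //.
  exact: finite_measure_integrable_cst.
under [X in EFin \o X]eq_fun do rewrite big_ord_recr/=.
under eq_Rintegral do rewrite big_ord_recr/=.
split; first exact: integrableD_EFin.
by rewrite RintegralD// big_ord_recr/=; exact: lerD.
Qed.

Lemma geometric_half_sum (R : realType) (n m : nat) :
  \sum_(i < m) 2^-1 ^+ (n + i) <= 2 * 2^-1 ^+ n :> R.
Proof.
suff -> : \sum_(i < m) 2^-1 ^+ (n + i) = 2 * 2^-1 ^+ n - 2 * 2^-1 ^+ (n + m)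
  :> R.
  by rewrite gerBl mulr_ge0// exprn_ge0// invr_ge0.
elim: m => [|m IH]; first by rewrite big_ord0 addn0 subrr.
by rewrite big_ord_recr/= IH addnS exprS; lra.
Qed.

(** Midpoints are all that [midpoint_closed_cauchy] asks for, and the inductive form lets the lower
    bound on the tested integral pass from the humps to their combinations by induction. *)
Inductive midpoint_hull d (T : measurableType d) (R : realType)
    (P : probability T R) (X : nat -> L0 P) (n : nat) : L0 P -> Prop :=
| midpoint_hull_base j : (n <= j)%N -> midpoint_hull X n (X j)
| midpoint_hull_mid Y Z : midpoint_hull X n Y -> midpoint_hull X n Z ->
    midpoint_hull X n (2^-1 *: (Y + Z)).

(** * Uniform integrability under the weight *)

Section weighted_uniform_integrability.
Context d (T : measurableType d) (R : realType) (P : probability T R).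
Implicit Types (X Y Z : L0 P) (K : set (L0 P)).

Lemma midpoint_hullS (X : nat -> L0 P) n m Y : (n <= m)%N ->
  midpoint_hull X m Y -> midpoint_hull X n Y.
Proof.
move=> nm; elim => [j mj|U V _ HU _ HV]; last exact: midpoint_hull_mid.
by apply: midpoint_hull_base; exact: leq_trans mj.
Qed.

Lemma midpoint_hull_convex (X : nat -> L0 P) n K : convex_set K ->
  (forall k, K (X k)) -> midpoint_hull X n `<=` K.
Proof.
move=> cK KX Y; elim => // U V _ KU _ KV.
have := convex_set_comb (t := 2^-1) cK KU KV.
rewrite (_ : 1 - 2^-1 = 2^-1 :> R); last by field.
by rewrite -scalerDr; apply; rewrite ?invr_ge0// invf_le1// ler1n.
Qed.

Lemma closure_L0P K X :
  closure K X <-> forall r : R, 0 < r -> exists2 Y, K Y & ball X r Y.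
Proof.
split=> [cX r r0|cX B /nbhs_ballP[r r0 rB]].
  by have [Y [KY XY]] := cX _ (nbhsx_ballx X r r0); exists Y.
by have [Y KY XY] := cX r r0; exists Y; split => //; exact: rB.
Qed.

Lemma weighted_uniform_integrability K (h : T -> R) (C : R) :
  convex_set K -> measurable_fun setT h -> (forall w, 0 <= h w <= 1) ->
  (forall X, closure K X -> P.-integrable setT (EFin \o X)) ->
  (forall X, closure K X -> \int[P]_w `|X w| <= C) ->
  (forall X (e : R), closure K X -> 0 < e -> exists2 r : R, 0 < r &
    forall Y, closure K Y -> ball X r Y ->
      \int[P]_w (h w * `|Y w - X w|) <= e) ->
  forall e : R, 0 < e -> exists l, forall X, K X -> weighted_tail h X l <= e.
Proof.
move=> cK mh h01 IA AC hcont e e0; apply: contrapT => /forallNP noUI.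
have KA := @subset_closure _ K.
have IK X : K X -> P.-integrable setT (EFin \o X) by move=> /KA /IA.
have KC X : K X -> \int[P]_w `|X w| <= C by move=> /KA /AC.
have Fe l : exists X, K X /\ e < weighted_tail h X l.
  have /existsNP[X /not_implyP[KX /negP]] := noUI l; rewrite -ltNge => eX.
  by exists X.
have [c [ec cub clb]] := limsup_witness e0
  (fun X l KX => weighted_tail_le mh h01 IK KC l KX) Fe.
have c0 : 0 < c := lt_le_trans e0 ec.
(* The main terms leave [2 * (c - del) - (c + del) = c - c / 4], and the choice of [n0] keeps the
   geometric errors below another [c / 4]; the remainder is [c / 2]. *)
pose del : R := c / 12.
have del0 : 0 < del by rewrite divr_gt0.
have [l1 l1P] := cub _ del0.
pose lhat := Num.max l1 0.
have lhat0 : 0 <= lhat by rewrite le_max lexx orbT.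
have lhatP X : K X -> weighted_tail h X lhat <= c + del.
  move=> KX; apply: le_trans (l1P _ KX); apply: le_Rintegral => //.
  - exact: (integrable_weighted_tail mh h01 IK).
  - exact: (integrable_weighted_tail mh h01 IK).
  move=> w _; have /andP[h0 h1] := h01 w.
  rewrite ler_wpM2l// ler_wpM2r// !indicE ler_nat.
  case: (boolP (w \in tail_set X lhat)) => //; rewrite inE /tail_set/= => lX.
  by rewrite mem_set//= (le_lt_trans _ lX)// le_max lexx.
have [X [l XlP]] := hump_sequence IK KC lhat (fun l => clb _ l del0).
have KX k : K (X k) by case: (XlP k).
have mF n m := measurable_hump_sign X l n m.
have Ia k : P.-integrable setT (EFin \o (\1_(tail_set (X k) (l k)) : T -> R)).
  apply: (@integrable_bounded _ _ _ _ _ 1); first exact: measurable_tail_indic.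
  by move=> w; have /andP[i0 i1] := indic01 R (tail_set (X k) (l k)) w;
    rewrite ger0_norm.
have IhF n m Y : P.-integrable setT (EFin \o Y) ->
    P.-integrable setT (EFin \o (fun w => h w * (hump_sign X l n m w * Y w))).
  move=> IY; apply: (integrable_dominated _ (integrable_norm_EFin IY)).
    by apply: measurable_funM => //; exact: measurable_funM.
  apply: aeW => w; have /andP[h0 h1] := h01 w;
    have F1 := hump_sign_le1 X l n m w.
  by rewrite !normrM (ger0_norm h0) mulrA ler_piMl// mulr_ile1.
have [n0 n0P] : exists n0, forall n, (n0 <= n)%N ->
    (2 + lhat) * (2 * 2^-1 ^+ n) < c / 4.
  have q0 : 0 < c / 4 / (2 + lhat) by rewrite !divr_gt0// ltr_wpDr.
  have [n0 n0P] := geometric_half_lt q0; exists n0 => n /n0P.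
  by rewrite ltr_pdivlMr ?ltr_wpDr// mulrC.
(* Since the total tail mass of [X j] beyond [lhat] is at most [c + del] and
   the hump carries at least [c - del], what is left outside the hump is small
   on the other tail sets. *)
have lower n j m : (n0 <= n)%N -> (n <= j)%N -> (j < n + m)%N ->
    c / 2 <= \int[P]_w (h w * (hump_sign X l n m w * X j w)).
  move=> n0n nj jm.
  pose f1 i w := if (j < n + i)%N then
    \1_(tail_set (X (n + i)%N) (l (n + i)%N)) w * `|X j w| else 0 : R.
  have [|i|If1 f1le] := @Rintegral_sum_le _ _ _ P f1 (fun i => 2^-1 ^+ (n +
    i)) m.
  - move=> i; rewrite /f1; case: (j < n + i)%N;
      last exact: finite_measure_integrable_cst.
    by apply: integrable_indicM;
      [exact/integrable_norm_EFin/IK|exact: measurable_tail_set].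
  - rewrite /f1; case: (boolP (j < n + i)%N) => ji;
      first by have [_ _ _ _] := XlP (n + i)%N; exact.
    by rewrite Rintegral_probability_cst exprn_ge0// invr_ge0.
  pose f2 i w := \1_(tail_set (X (n + i)%N) (l (n + i)%N)) w : R.
  have [|i|If2 f2le] := @Rintegral_sum_le _ _ _ P f2 (fun i => 2^-1 ^+ (n +
    i)) m.
  - by move=> i; exact: Ia.
  - by have [_ _ _ ->] := XlP (n + i)%N.
  have It l' := integrable_weighted_tail mh h01 IK l' (KX j).
  have := n0P _ n0n; have := geometric_half_sum R n m.
  have [_ lj cj _ _] := XlP j; have := lhatP _ (KX j).
  have h1 : \int[P]_w (2 * (h w * (\1_(tail_set (X j) (l j)) w * `|X j w|)) +
      -1 * (h w * (\1_(tail_set (X j) lhat) w * `|X j w|)) +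
      (-2 * (\sum_(i < m) f1 i w) + - lhat * (\sum_(i < m) f2 i w)))
    <= \int[P]_w (h w * (hump_sign X l n m w * X j w)).
    apply: le_Rintegral => //.
    - by apply: integrableD_EFin; apply: integrableD_EFin;
        exact: integrableZ_EFin.
    - exact/IhF/IK.
    - by move=> w _; exact: weighted_hump_sign_lower.
  move: h1; rewrite RintegralD//; last 2 first.
    by apply: integrableD_EFin; exact: integrableZ_EFin.
    by apply: integrableD_EFin; exact: integrableZ_EFin.
  rewrite RintegralD//; [|exact: integrableZ_EFin|exact: integrableZ_EFin].
  rewrite RintegralD//; [|exact: integrableZ_EFin|exact: integrableZ_EFin].
  rewrite !RintegralZl// -/(weighted_tail h (X j) (l j)).
  rewrite -/(weighted_tail h (X j) lhat) => bound tail_le geo small.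
  have S1 := le_trans f1le geo; have S2 := le_trans f2le geo.
  rewrite /del in tail_le cj.
  have := ler_wpM2l lhat0 S2; move: bound tail_le small cj S1.
  rewrite [(2 + lhat) * _]mulrDl mulNr [- lhat * _]mulNr.
  move: (weighted_tail h (X j) (l j)) (weighted_tail h (X j) lhat).
  move: (\int[P]_w (\sum_(i < m) f1 i w)) (lhat * \int[P]_w _) (2 * 2^-1 ^+ n).
  move=> a1 a2 q b1 b2; move: (lhat * q) (\int[P]_w _); by clear=> *; lra.
(* For a fixed sign the tested integral is linear in [Y], so midpoints preserve the bound; [M]
   ensures that the window [[n, n + m[] contains every hump used in [Y]. *)
have hull_lower n Y : (n0 <= n)%N -> midpoint_hull X n Y ->
    exists M, forall m, (M <= m)%N ->
      c / 2 <= \int[P]_w (h w * (hump_sign X l n m w * Y w)).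
  move=> n0n; elim => [j nj|U V HU [M1 M1P] HV [M2 M2P]].
    exists j.+1 => m jm; apply: lower => //.
    by rewrite (leq_trans jm)// leq_addl.
  exists (maxn M1 M2) => m; rewrite geq_max => /andP[/M1P m1 /M2P m2].
  have IU : P.-integrable setT (EFin \o U) by apply/IK/(midpoint_hull_convex
    cK KX HU).
  have IV : P.-integrable setT (EFin \o V) by apply/IK/(midpoint_hull_convex
    cK KX HV).
  have HUV := midpoint_hull_mid HU HV.
  have IUV := IK _ (midpoint_hull_convex cK KX HUV).
  apply: (@le_trans _ _ (\int[P]_w (2^-1 * (h w * (hump_sign X l n m w * U w) +
      h w * (hump_sign X l n m w * V w))))).
    rewrite RintegralZl//; last by apply: integrableD_EFin; exact: IhF.
    by rewrite RintegralD//; [lra|exact: IhF|exact: IhF].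
  apply: le_Rintegral_ae.
  - by apply: integrableZ_EFin; apply: integrableD_EFin; exact: IhF.
  - exact: IhF.
  apply: filterS2 (L0_scaleE 2^-1 (U + V)) (L0_addE U V) => w ZE YE.
  by rewrite ZE YE le_eqVlt; apply/orP; left; apply/eqP; ring.
have [Y [HY YC]] : exists Y : nat ->
  L0 P, (forall n, midpoint_hull X n (Y n)) /\
    forall e : R, 0 < e -> exists N, forall m n, (N <= m)%N -> (N <= n)%N ->
      (P [set w | e <= `|Y m w - Y n w|]%R < e%:E)%E.
  apply: (@midpoint_closed_cauchy _ _ _ _ _ C).
  - by move=> n Z; exact: midpoint_hullS.
  - by move=> n; exists (X n); exact: midpoint_hull_base.
  - by move=> n U V; exact: midpoint_hull_mid.
  - by move=> n Z /(midpoint_hull_convex cK KX)/IK.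
  - by move=> n Z /(midpoint_hull_convex cK KX)/KC.
have KY n : K (Y n) by exact: midpoint_hull_convex (HY n).
have [g gP] := @cauchy_in_probability_cvg _ _ _ P (fun n => Y n) YC.
pose Z := L0_class P g.
have Zball r : 0 < r -> exists N, forall n, (N <= n)%N -> ball Z r (Y n).
  move=> r0; have [N NP] := gP _ r0; exists N => n /NP; apply: le_lt_trans.
  apply: le_measure_ae; [exact: measurable_ge_dist|exact: measurable_ge_dist|].
  by apply: filterS (L0_classK P g) => w Zg /=; rewrite Zg distrC.
have AZ : closure K Z.
  by apply/closure_L0P => r /Zball[N /(_ N (leqnn N)) NP]; exists (Y N).
have c8 : 0 < c / 8 by rewrite divr_gt0.
have [r r0 rP] := hcont _ _ AZ c8; have [N1 N1P] := Zball _ r0.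
have [s s0 sP] := integrable_small_set (IA _ AZ) c8.
have [N2 N2P] := geometric_half_lt s0.
(* [n] is fixed before the window length [M], which depends on [Y n]; this is harmless because the
   support [D] of the sign has probability at most [2 * 2^-1 ^+ n] for every [M]. *)
pose n := maxn n0 (maxn N1 N2).
have [nn0 nN1 nN2] : [/\ (n0 <= n)%N, (N1 <= n)%N & (N2 <= n)%N].
  by rewrite /n !leq_max !leqnn !orbT.
have [M /(_ M (leqnn M)) cM] := hull_lower n (Y n) nn0 (HY n).
pose D := [set w | 1 <= `|hump_sign X l n M w|].
have mnF : measurable_fun setT (fun w => `|hump_sign X l n M w|).
  by apply: measurableT_comp.
have mD : measurable D by exact: measurable_set_ge.
have InF : P.-integrable setT (EFin \o (fun w => `|hump_sign X l n M w|)).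
  apply: (@integrable_bounded _ _ _ _ _ 1) => // w; rewrite normr_id.
  exact: hump_sign_le1.
have PD : (P D < s%:E)%E.
  apply: le_lt_trans (markov_Rintegral InF (fun w => normr_ge0 _) ltr01) _.
  rewrite divr1 lte_fin; apply: le_lt_trans (N2P _ nN2).
  pose f2 i w := \1_(tail_set (X (n + i)%N) (l (n + i)%N)) w : R.
  have [|i|If2 f2le] := @Rintegral_sum_le _ _ _ P f2 (fun i => 2^-1 ^+ (n +
    i)) M.
  - by move=> i; exact: Ia.
  - by have [_ _ _ ->] := XlP (n + i)%N.
  apply: le_trans (geometric_half_sum R n M); apply: le_trans f2le.
  by apply: le_Rintegral => // w _; exact: hump_sign_le_sum.
have IYn := IK _ (KY n).
have IdZ := integrable_dist (IA _ AZ) IYn.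
have IhdZ : P.-integrable setT (EFin \o (fun w => h w * `|Y n w - Z w|)).
  exact: integrableM01.
have IDZ : P.-integrable setT (EFin \o (fun w => \1_D w * `|Z w|)).
  by apply: integrable_indicM => //; exact/integrable_norm_EFin/IA.
(* The sign vanishes off [D], and on [D] the weighted [|Y n|] is at most the weighted distance to
   [Z] plus [|Z|]. Each of the two integrals is at most [c / 8], which contradicts [c / 2]. *)
have : c / 2 <= \int[P]_w (h w * `|Y n w - Z w| + \1_D w * `|Z w|).
  apply: le_trans cM _; apply: le_Rintegral => //.
  - exact: IhF.
  - exact: integrableD_EFin.
  move=> w _; have /andP[h0 h1] := h01 w.
  apply: le_trans (ler_norm _) _; rewrite !normrM (ger0_norm h0).
  case: (hump_sign_norm X l n M w) => FE.
    by rewrite FE mul0r mulr0 addr_ge0// mulr_ge0// indicE.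
  rewrite FE mul1r [\1_D w]indicE mem_set ?mul1r; last by rewrite /D/= FE.
  have := ler_normD (Y n w - Z w) (Z w); rewrite subrK => YZ.
  have := ler_wpM2l h0 YZ; have : h w * `|Z w| <= `|Z w| by rewrite ler_piMl.
  by rewrite mulrDr; lra.
rewrite RintegralD//.
have := rP _ (KA _ (KY n)) (N1P _ nN1); have := sP _ mD PD; lra.
Qed.

End weighted_uniform_integrability.

(** * The equivalence *)

Section change_of_measure.
Context d (T : measurableType d) (R : realType) (P : probability T R).
Implicit Types (X Y Z : L0 P) (K : set (L0 P)).

Lemma density_probability (f : T -> R) : measurable_fun setT f ->
  (forall w, 0 <= f w) -> (\int[P]_w (f w)%:E = 1)%E ->
  exists Q : probability T R,
    forall A, measurable A -> Q A = (\int[P]_(w in A) (f w)%:E)%E.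
Proof.
move=> mf f0 f1; pose nu A := (\int[P]_(w in A) (f w)%:E)%E.
have nu0 : nu set0 = 0%E by exact: integral_set0.
have nu_ge0 A : (0 <= nu A)%E by apply: integral_ge0 => w _; rewrite lee_fin.
have nu_sa : semi_sigma_additive nu.
  by apply: semi_sigma_additive_nng_induced;
    [exact/measurable_EFinP|move=> w; rewrite lee_fin].
pose nuM : {measure set T -> \bar R} := HB.pack nu
  (isMeasure.Build d T R nu nu0 nu_ge0 nu_sa).
have nu1 : nuM setT = 1%E by exact: f1.
pose Q : probability T R := HB.pack nu nuM
  (Measure_isProbability.Build d T R nuM nu1).
by exists Q.
Qed.

(** By a.e. uniqueness [f] is a version of the Radon-Nikodym derivative, for which the change of
    variables is known. *)
Lemma density_integral (Q : probability T R) (f : T -> R) :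
  measurable_fun setT f -> (forall w, 0 <= f w) ->
  (forall A, measurable A -> Q A = (\int[P]_(w in A) (f w)%:E)%E) ->
  forall (E : set T) (g : T -> R), measurable E -> measurable_fun setT g ->
    (forall w, 0 <= g w) ->
  (\int[Q]_(w in E) (g w)%:E = \int[P]_(w in E) (f w * g w)%:E)%E.
Proof.
move=> mf f0 Qf E g mE mg g0.
have QP : Q `<< P.
  apply/null_content_dominatesP => A mA PA; rewrite Qf//.
  by apply: null_set_integral => //; apply/measurable_funTS/measurable_EFinP.
rewrite -(Radon_Nikodym_SigmaFinite.change_of_variables QP)//; last first.
  exact/measurable_funTS/measurable_EFinP.
have IRN := Radon_Nikodym_SigmaFinite.f_integrable QP.
have RNf : ae_eq P setT (Radon_Nikodym_SigmaFinite.f Q P) (EFin \o f).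
  apply: integral_ae_eq => //; first exact/measurable_EFinP.
  by move=> A _ mA; rewrite -Radon_Nikodym_SigmaFinite.f_integral//; exact: Qf.
apply: ae_eq_integral => //.
- apply: emeasurable_funM; first exact/measurable_funTS/measurable_EFinP.
  exact/measurable_funTS/(measurable_int _ IRN).
- apply/measurable_funTS/measurable_EFinP; exact: measurable_funM.
- by apply: filterS RNf => w -> // _; rewrite EFinM muleC.
Qed.

Lemma null_dominates_small (Q : probability T R) (e : R) : Q `<< P -> 0 < e ->
  exists2 r : R, 0 < r &
    forall A, measurable A -> (P A < r%:E)%E -> (Q A < e%:E)%E.
Proof.
move=> QP e0; pose nu := charge_of_finite_measure Q.
have [p [n pn]] := Hahn_decomposition nu.
have [r [r0 rP]] := charge_variation_continuous pn QP e0.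
exists r => // A mA PA; apply: le_lt_trans (rP A mA PA).
apply: le_trans (abse_charge_variation pn mA).
by rewrite gee0_abs.
Qed.

(** Lower semicontinuity of the mean of [|Z|] under [Q] for convergence in probability under [P].
    Truncation at [k] limits the loss on the exceptional event [B] to [k] times [Q B]. *)
Lemma integral_le_approx (Q : probability T R) Z (c : R) : Q `<< P ->
  (forall r : R, 0 < r -> exists2 Z' : L0 P, ball Z r Z' &
    (\int[Q]_w `|Z' w|%:E <= c%:E)%E) ->
  (\int[Q]_w `|Z w|%:E <= c%:E)%E.
Proof.
move=> QP Zc; have mn (X : L0 P) : measurable_fun setT (fun w => `|X w|).
  exact: measurableT_comp.
apply: (@integral_le_cvg _ _ _ Q (fun k w => Num.min `|Z w| k%:R)).
- by move=> k; exact: measurable_minr.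
- by move=> k w; rewrite le_min normr_ge0 ler0n.
- move=> w; apply: cvg_near_cst.
  exists (Num.bound `|Z w|) => // k /= Nk; rewrite min_l//.
  apply: le_trans (ltW (Num.Theory.archi_boundP (normr_ge0 _))) _.
  by rewrite ler_nat.
move=> k; apply/lee_addgt0Pr => e e0.
(* Dividing by [k + 1] rather than [k] covers [k = 0]; the loss on [B] is still at most [e / 2]. *)
have e1 : 0 < e / 2 / k.+1%:R by rewrite !divr_gt0.
have [s s0 sP] := null_dominates_small QP e1.
pose r := Num.min s (e / 2).
have r0 : 0 < r by rewrite lt_min s0 divr_gt0.
have [Z' ZZ' Z'c] := Zc r r0.
pose B := [set w | r <= `|Z w - Z' w|].
have mB : measurable B by exact: measurable_ge_dist.
have QB : (Q B < (e / 2 / k.+1%:R)%:E)%E.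
  apply: sP => //; apply: lt_le_trans ZZ' _.
  by rewrite lee_fin ge_min lexx.
have mi : measurable_fun setT (\1_B : T -> R) by exact: measurable_indic.
have m2 : measurable_fun setT (fun w => r + k%:R * \1_B w).
  by apply: measurable_funD => //; exact: measurable_funM.
have i0 w : 0 <= (\1_B w : R) by rewrite indicE.
apply: (@le_trans _ _ (\int[Q]_w (`|Z' w|%:E + (r + k%:R * \1_B w)%:E)%E)%E).
  apply: ge0_le_integral => //.
  - exact/measurable_EFinP/measurable_minr.
  - by apply: emeasurable_funD; exact/measurable_EFinP.
  move=> w _; rewrite -EFinD lee_fin.
  have [rZ|Zr] := leP r `|Z w - Z' w|.
    rewrite indicE mem_set//= mulr1; apply: (@le_trans _ _ k%:R).
      by rewrite ge_min lexx orbT.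
    by rewrite addrA lerDr addr_ge0// ltW.
  apply: (@le_trans _ _ `|Z w|); first by rewrite ge_min lexx.
  have := ler_normD (Z' w) (Z w - Z' w); rewrite addrC subrK => /le_trans;
    apply.
  by rewrite lerD2l (le_trans (ltW Zr))// lerDl mulr_ge0.
rewrite ge0_integralD//; last 3 first.
- exact/measurable_EFinP.
- by move=> w _; rewrite lee_fin addr_ge0 ?mulr_ge0// ltW.
- exact/measurable_EFinP.
apply: leeD => //.
under eq_integral do rewrite EFinD EFinM.
rewrite ge0_integralD//; last 2 first.
- by move=> w _; rewrite lee_fin ltW.
- by apply: emeasurable_funM => //; exact/measurable_EFinP.
rewrite integral_cst//= probability_setT mule1.
rewrite ge0_integralZl//; last first.
  exact/measurable_EFinP.
rewrite integral_indic// setIT.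
apply: (@le_trans _ _ ((e / 2)%:E + (k%:R)%:E * (e / 2 / k.+1%:R)%:E)%E).
  apply: leeD; first by rewrite lee_fin ge_min lexx orbT.
  by apply: lee_wpmul2l; [rewrite lee_fin|exact: ltW].
rewrite -EFinM -EFinD lee_fin [leRHS]splitr lerD2l mulrCA.
rewrite ler_piMr//; first by rewrite divr_ge0// ltW.
by rewrite ler_pdivrMr// mul1r ler_nat.
Qed.

Lemma integral_pos_eq0 (f : T -> R) (A : set T) : measurable A ->
  measurable_fun setT f -> {ae P, forall w, 0 < f w} ->
  (\int[P]_(w in A) `|f w|%:E = 0)%E -> P A = 0%E.
Proof.
move=> mA mf f0 /(ae_eq_integral_abs P mA (proj2 (measurable_EFinP _ _)
  (measurable_funTS mf))) fA.
apply/eqP; rewrite eq_le measure_ge0 andbT -(measure0 P).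
apply: le_measure_ae => //; apply: filterS2 f0 fA => w fw fAw Aw.
by have [fw0] := fAw Aw; move: fw; rewrite fw0 ltxx.
Qed.

End change_of_measure.

(** * Construction of the equivalent measure *)

Section equivalence.
Context d (T : measurableType d) (R : realType) (P : probability T R).
Implicit Types (X Y Z : L0 P) (K : set (L0 P)).

Lemma integral_indicM (mu : {measure set T ->
  \bar R}) (A : set T) (f : T -> R) :
  (\int[mu]_(w in A) (f w)%:E = \int[mu]_w (\1_A w * f w)%:E)%E.
Proof.
rewrite integral_mkcond; apply: eq_integral => w _.
by rewrite patchE indicE; case: (w \in A); rewrite ?mul1r ?mul0r.
Qed.

Lemma integrable_norm_le (mu : probability T R) (f : T -> R) (c : R) :
  measurable_fun setT f -> (\int[mu]_w `|f w|%:E <= c%:E)%E ->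
  mu.-integrable setT (EFin \o f).
Proof.
move=> mf fc; apply/integrableP; split; first exact/measurable_EFinP.
by apply: le_lt_trans fc _; exact: ltry.
Qed.

Lemma bounded_in_L1_closure K : bounded_in_L1 K ->
  exists C, forall X, closure K X -> (\int[P]_w `|X w|%:E <= C%:E)%E.
Proof.
rewrite /bounded_in_L1; set s := ereal_sup _ => soo.
have [C sC] : exists C : R, (s <= C%:E)%E.
  (* The supremum is [-oo] when [K] is empty, and then any constant will do. *)
  by move: soo; case: s => [C _|//|_]; [exists C|exists 0; rewrite leNye].
exists C => X /closure_L0P KX; apply: (integral_le_approx (P := P)) => // r r0.
have [Y KY XY] := KX r r0; exists Y => //; apply: le_trans sC.
apply: ereal_sup_ubound; exists Y => //; by rewrite unlock.
Qed.

Lemma uniformly_locally_convex_solid_uniformly_integrable K :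
  convex_set K -> bounded_in_L1 K ->
  uniformly_locally_convex_solid (closure K) (closure K) ->
  exists Q : probability T R, equivalent_measures Q P /\ uniformly_integrable
    Q K.
Proof.
move=> cK bK lcs.
have [K0|nK0] := pselect (K !=set0); last first.
  exists P; split; first by split.
  by move=> e e0; apply: nearW => l X KX; exfalso; apply: nK0; exists X.
have [C AC] := bounded_in_L1_closure bK.
have IA X : closure K X -> P.-integrable setT (EFin \o X).
  by move=> /AC; exact: integrable_norm_le.
have AC' X : closure K X -> \int[P]_w `|X w| <= C.
  move=> AX; rewrite -lee_fin EFin_Rintegral; first exact: AC.
  exact/integrable_norm_EFin/IA.
have A0 : closure K !=set0.
  by have [X KX] := K0; exists X; exact: subset_closure.
have [h [mh h01 h0 hcont]] :=
  uniformly_locally_convex_solid_weight lcs A0 IA AC'.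
have hUI := weighted_uniform_integrability cK mh h01 IA AC' hcont.
have Ih : P.-integrable setT (EFin \o h).
  by apply: (@integrable_bounded _ _ _ _ _ 1) => // w; have /andP[? ?] := h01 w;
    rewrite ger0_norm.
pose c := \int[P]_w h w.
have c0 : 0 < c.
  have hge w : 0 <= h w by have /andP[] := h01 w.
  rewrite lt_neqAle Rintegral_ge0// andbT eq_sym; apply/eqP => cE.
  suff : P setT = 0%E by rewrite probability_setT => /eqP; rewrite onee_eq0.
  apply: (integral_pos_eq0 measurableT mh h0).
  under eq_integral do rewrite ger0_norm//.
  by rewrite -EFin_Rintegral// -/c cE.
pose f w := h w / c.
have mf : measurable_fun setT f by exact: measurable_funM.
have f0 w : 0 <= f w by have /andP[? _] := h01 w; rewrite divr_ge0// ltW.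
have f1 : (\int[P]_w (f w)%:E = 1)%E.
  rewrite -EFin_Rintegral; last first.
    rewrite (_ : _ \o _ = EFin \o (fun w => c^-1 * h w)).
      exact: integrableZ_EFin.
    by apply/funext => w; rewrite /= mulrC.
  under eq_Rintegral do rewrite /f mulrC.
  by rewrite RintegralZl// -/c mulVf// gt_eqF.
have [Q Qf] := density_probability mf f0 f1.
exists Q; split; first split.
- apply/null_content_dominatesP => A mA PA; rewrite Qf//.
  by apply: null_set_integral => //; apply/measurable_funTS/measurable_EFinP.
- apply/null_content_dominatesP => A mA QA.
  have {}QA : (\int[P]_(w in A) (f w)%:E = 0)%E by rewrite -Qf.
  apply: (integral_pos_eq0 mA mf).
    by apply: filterS h0 => w hw; rewrite divr_gt0.
  by under eq_integral do rewrite ger0_norm//.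
(* The tolerance is scaled by [c] because the density of [Q] is [h / c]. *)
move=> e e0; have ec0 : 0 < e * c by exact: mulr_gt0.
have [l0 l0P] := hUI _ ec0.
exists l0; split; first exact: num_real.
move=> l l0l X KX.
have mX : measurable_fun setT (fun w => `|X w|) by exact: measurableT_comp.
rewrite (density_integral mf f0 Qf)//; last exact: measurable_tail_set.
have IK Y : K Y -> P.-integrable setT (EFin \o Y).
  by move=> /subset_closure; exact: IA.
have It k := integrable_weighted_tail mh h01 IK k KX.
apply: (@le_trans _ _ (\int[P]_w (c^-1 * (h w * (\1_(tail_set X l0) w * `|X
  w|)))%:E)%E).
  rewrite integral_indicM; apply: ge0_le_integral => //.
  - by move=> w _; rewrite lee_fin; apply: mulr_ge0 => //; exact: mulr_ge0.
  - apply/measurable_EFinP; apply: measurable_funM; last exact: measurable_funM.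
    by apply: measurable_indic; exact: measurable_tail_set.
  - by apply/measurable_EFinP; apply: measurable_funM => //;
      exact: integrable_measurable (It l0).
  move=> w _; rewrite lee_fin /f.
  have -> (a b x y : R) : a * (b * x * y) = x * (b * (a * y)) by ring.
  have /andP[h0w _] := h01 w.
  rewrite ler_wpM2l ?invr_ge0 ?(ltW c0)// ler_wpM2l// ler_wpM2r// !indicE
    ler_nat.
  case: (boolP (w \in [set w | l < `|X w|])) => //; rewrite inE/= => lX.
  by rewrite mem_set//=; exact: lt_trans lX.
rewrite -EFin_Rintegral; last exact: integrableZ_EFin.
rewrite lee_fin RintegralZl// mulrC ler_pdivrMr//; exact: l0P.
Qed.

Lemma measurable_L0 X : measurable_fun setT X.
Proof. by []. Qed.

Lemma ae_null_dominates (Q : probability T R) (p : T -> Prop) : Q `<< P ->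
  {ae P, forall w, p w} -> {ae Q, forall w, p w}.
Proof.
move=> /null_content_dominatesP QP [A [mA PA pA]]; exists A; split => //.
exact: QP.
Qed.

Lemma L0_subE X Y : {ae P, forall w, (X - Y : L0 P) w = X w - Y w}.
Proof.
have hN : {ae P, forall w, (- Y : L0 P) w = - Y w} by exact: L0_classK.
by apply: filterS2 (L0_addE X (- Y)) hN => w -> ->.
Qed.

Lemma L0_ball_sub X X' Y Y' (r r' : R) : ball X r X' -> ball Y r' Y' ->
  ball (X - Y : L0 P) (r + r') (X' - Y' : L0 P).
Proof.
move=> XX' YY'.
pose f : {mfun T >-> R} := (X : {mfun T >-> R}) - (Y : {mfun T >-> R}).
pose g : {mfun T >-> R} := (X' : {mfun T >-> R}) - (Y : {mfun T >-> R}).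
pose k : {mfun T >-> R} := (X' : {mfun T >-> R}) - (Y' : {mfun T >-> R}).
have fE w : f w = X w - Y w by [].
have gE w : g w = X' w - Y w by [].
have kE w : k w = X' w - Y' w by [].
have fg : (P [set w | r <= `|f w - g w|]%R < r%:E)%E.
  apply: le_lt_trans XX'; apply: le_measure_ae; try exact: measurable_ge_dist.
  apply: aeW => w; rewrite /mkset fE gE.
  by rewrite opprB addrA subrK.
have gk : (P [set w | r' <= `|g w - k w|]%R < r'%:E)%E.
  apply: le_lt_trans YY'; apply: le_measure_ae; try exact: measurable_ge_dist.
  apply: aeW => w; rewrite /mkset gE kE (_ : _ - _ = Y' w - Y w); last by ring.
  by rewrite distrC.
apply: le_lt_trans (dist_lt_triangle fg gk).
apply: le_measure_ae; try exact: measurable_ge_dist.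
apply: filterS2 (L0_subE X Y) (L0_subE X' Y') => w XYE XYE'.
by rewrite /mkset XYE XYE' fE kE.
Qed.

(** * From uniform integrability to local convex-solidity *)

Section uniform_integrability.
Variables (Q : probability T R) (K : set (L0 P)).
Hypotheses (QP : Q `<< P) (UI : uniformly_integrable Q K).

(** Off the event [B] the distance is below [r]; on it, each variable is at most [l] plus its tail.
    The four contributions [r], [2 * l * Q B] and the two tails are at most [del / 4] each. *)
Lemma uniformly_integrable_close (del : R) : 0 < del ->
  exists2 r : R, 0 < r & forall X Y, K X -> K Y -> ball X r Y ->
    (\int[Q]_w `|Y w - X w|%:E <= del%:E)%E.
Proof.
move=> del0; have d4 : 0 < del / 4 by rewrite divr_gt0.
have [M [_ MP]] := UI d4.
(* The tail bound holds at levels strictly above [M], and [l] must also be positive. *)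
pose l := Num.max M 0 + 1.
have l0 : 0 < l by rewrite ltr_wpDl// le_max lexx orbT.
have {}MP X : K X -> (\int[Q]_(w in tail_set X l) `|X w|%:E <= (del / 4)%:E)%E.
  by apply: MP; rewrite (@le_lt_trans _ _ (Num.max M 0))// ?ltrDl// le_max lexx.
have Itail X : K X -> Q.-integrable setT
    (EFin \o (fun w => \1_(tail_set X l) w * `|X w|)).
  move=> /MP; rewrite integral_indicM => XM.
  apply: (integrable_norm_le (c := del / 4)).
    apply: measurable_funM; last exact: measurableT_comp.
    by apply: measurable_indic; exact: measurable_tail_set.
  by under eq_integral do rewrite ger0_norm ?mulr_ge0//.
have tail_le X : K X -> \int[Q]_w (\1_(tail_set X l) w * `|X w|) <= del / 4.
  by move=> KX; rewrite -lee_fin EFin_Rintegral ?Itail// -integral_indicM MP.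
have e1 : 0 < del / (8 * l) by rewrite divr_gt0// mulr_gt0.
have [s s0 sP] := null_dominates_small QP e1.
pose r := Num.min s (del / 4).
have r0 : 0 < r by rewrite lt_min s0.
exists r => // X Y KX KY XY.
pose B := [set w | r <= `|X w - Y w|].
have mB : measurable B by exact: measurable_ge_dist.
have QB : (Q B < (del / (8 * l))%:E)%E.
  by apply: sP => //; apply: lt_le_trans XY _; rewrite lee_fin ge_min lexx.
have IB : Q.-integrable setT (EFin \o (\1_B : T -> R)).
  apply: (@integrable_bounded _ _ _ _ _ 1); first exact: measurable_indic.
  by move=> w; have /andP[? ?] := indic01 R B w; rewrite ger0_norm.
pose G w := (r + 2 * l * \1_B w) +
  (\1_(tail_set X l) w * `|X w| + \1_(tail_set Y l) w * `|Y w|).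
have Ir : Q.-integrable setT (EFin \o (cst r : T -> R)).
  exact: finite_measure_integrable_cst.
have IG1 : Q.-integrable setT (EFin \o (fun w => r + 2 * l * \1_B w)).
  by apply: integrableD_EFin => //; exact: integrableZ_EFin.
have IG2 := integrableD_EFin (Itail _ KX) (Itail _ KY).
have IG : Q.-integrable setT (EFin \o G) by exact: integrableD_EFin.
apply: (@le_trans _ _ (\int[Q]_w (G w)%:E)%E).
  apply: ge0_le_integral => //.
  - by apply/measurable_EFinP; apply: measurableT_comp => //;
      exact: measurable_funB.
  - exact/measurable_EFinP/(integrable_measurable IG).
  move=> w _; rewrite lee_fin distrC /G.
  have i0 (A : set T) : 0 <= (\1_A w : R) by have /andP[] := indic01 R A w.
  have [rw|wr] := leP r `|X w - Y w|; last first.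
    have h1 : 0 <= 2 * l * \1_B w by rewrite mulr_ge0// mulr_ge0// ltW.
    have h2 (Z : L0 P) : 0 <= \1_(tail_set Z l) w * `|Z w| by exact: mulr_ge0.
    by have := h2 X; have := h2 Y; move: wr h1; lra.
  rewrite [\1_B w]indicE mem_set//= mulr1.
  have tw (Z : L0 P) : `|Z w| <= l + \1_(tail_set Z l) w * `|Z w|.
    have [lZ|Zl] := ltP l `|Z w|.
      by rewrite indicE mem_set//= mul1r lerDr ltW.
    by apply: le_trans Zl _; rewrite lerDl mulr_ge0.
  by have := tw X; have := tw Y; have := ler_normB (X w) (Y w); lra.
rewrite -EFin_Rintegral// lee_fin.
rewrite RintegralD// RintegralD//; last exact: integrableZ_EFin.
rewrite RintegralD//; [|exact: Itail|exact: Itail].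
rewrite RintegralZl// Rintegral_probability_cst.
have QB' : \int[Q]_w \1_B w <= del / (8 * l).
  by rewrite -lee_fin EFin_Rintegral// integral_indic// setIT ltW.
have := ler_wpM2l (ltW l0) QB'.
rewrite (_ : l * (del / (8 * l)) = del / 8); last by field; rewrite gt_eqF.
have : r <= del / 4 by rewrite ge_min lexx orbT.
have := tail_le _ KX; have := tail_le _ KY; lra.
Qed.

(** The tails are controlled on [K] only, so points of the closure are approximated from [K], and
    lower semicontinuity brings the bound back. The radius is halved to leave room for the two
    approximations, each within a quarter of [r]. *)
Lemma uniformly_integrable_closure_close (del : R) : 0 < del ->
  exists2 r : R, 0 < r & forall X Y, closure K X -> closure K Y -> ball X r Y ->
    (\int[Q]_w `|(Y - X : L0 P) w|%:E <= del%:E)%E.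
Proof.
move=> /uniformly_integrable_close[r r0 rP].
have r2 : 0 < r / 2 by rewrite divr_gt0.
exists (r / 2) => // X Y AX AY XY; apply: integral_le_approx => // s s0.
pose t := Num.min (s / 2) (r / 2 / 2).
have t0 : 0 < t by rewrite lt_min !divr_gt0.
have [X' KX' XX'] := proj1 (closure_L0P _ _) AX _ t0.
have [Y' KY' YY'] := proj1 (closure_L0P _ _) AY _ t0.
exists (Y' - X' : L0 P).
  apply: (@le_ball _ _ _ (t + t)).
    by rewrite [leRHS]splitr lerD// ge_min lexx.
  exact: L0_ball_sub.
have XY' : ball X' r Y'.
  apply: (@le_ball _ _ _ (t + r / 2 + t)).
    have : t <= r / 2 / 2 by rewrite ge_min lexx orbT.
    lra.
  apply: ball_triangle YY'; apply: ball_triangle XY; exact: ball_sym.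
apply: le_trans (rP _ _ KX' KY' XY'); apply: ae_ge0_le_integral => //.
- by apply/measurable_EFinP; apply: measurableT_comp.
- by apply/measurable_EFinP; apply: measurableT_comp => //;
    exact: measurable_funB.
- apply: ae_null_dominates QP _; apply: filterS (L0_subE Y' X') => w -> _.
  exact: lexx.
Qed.

Lemma convex_solid_L1_ball (del : R) :
  convex_solid [set Z : L0 P | (\int[Q]_w `|Z w|%:E <= del%:E)%E].
Proof.
have cvx X Y (t : {i01 R}) : (\int[Q]_w `|X w|%:E <= del%:E)%E ->
    (\int[Q]_w `|Y w|%:E <= del%:E)%E ->
    (\int[Q]_w `|(t%:num *: X + (1 - t%:num) *: Y : L0 P) w|%:E <= del%:E)%E.
  move=> XW YW.
  have IX := integrable_norm_le (measurable_L0 X) XW.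
  have IY := integrable_norm_le (measurable_L0 Y) YW.
  have XW' : \int[Q]_w `|X w| <= del.
    by rewrite -lee_fin EFin_Rintegral//; exact: integrable_norm_EFin.
  have YW' : \int[Q]_w `|Y w| <= del.
    by rewrite -lee_fin EFin_Rintegral//; exact: integrable_norm_EFin.
  have t0 : 0 <= t%:num by [].
  have t1 : t%:num <= 1 by [].
  have tE : {ae P, forall w, (t%:num *: X + (1 - t%:num) *: Y : L0 P) w =
      t%:num * X w + (1 - t%:num) * Y w}.
    have := L0_addE (t%:num *: X) ((1 - t%:num) *: Y).
    apply: filterS3 (L0_scaleE t%:num X) (L0_scaleE (1 - t%:num) Y) => w.
    by move=> -> -> ->.
  have I2 : Q.-integrable setT (EFin \o
      (fun w => t%:num * `|X w| + (1 - t%:num) * `|Y w|)).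
    by apply: integrableD_EFin; apply/integrableZ_EFin/integrable_norm_EFin.
  apply: (@le_trans _ _ (\int[Q]_w (t%:num * `|X w| + (1 - t%:num) * `|Y
    w|)%:E)%E).
    apply: ae_ge0_le_integral => //.
    - by apply/measurable_EFinP; apply: measurableT_comp.
    - exact/measurable_EFinP/(integrable_measurable I2).
    apply: ae_null_dominates QP _; apply: filterS tE => w twE _.
    rewrite lee_fin [X in `|X|]twE (le_trans (ler_normD _ _))// !normrM.
    by rewrite (ger0_norm t0) (@ger0_norm _ (1 - t%:num)) ?subr_ge0.
  rewrite -EFin_Rintegral// lee_fin RintegralD//; last 2 first.
    exact/integrableZ_EFin/integrable_norm_EFin.
    exact/integrableZ_EFin/integrable_norm_EFin.
  rewrite !RintegralZl//; last 2 first.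
    exact: integrable_norm_EFin.
    exact: integrable_norm_EFin.
  have := ler_wpM2l t0 XW'; have t1' : 0 <= 1 - t%:num by rewrite subr_ge0.
  have := ler_wpM2l t1' YW'; lra.
split=> [X Y t|X Y /= XW YX]; first by rewrite !inE; exact: cvx.
apply: le_trans XW; apply: ae_ge0_le_integral => //.
- by apply/measurable_EFinP; apply: measurableT_comp.
- by apply/measurable_EFinP; apply: measurableT_comp.
- by apply: ae_null_dominates QP _; apply: filterS YX => w YXw _;
    rewrite lee_fin.
Qed.

Lemma uniformly_integrable_locally_convex_solid : P `<< Q ->
  uniformly_locally_convex_solid (closure K) (closure K).
Proof.
move=> PQ U /nbhs_ballP[e /= e0 eU].
have [s s0 sP] := null_dominates_small PQ e0.
(* Markov under [Q] gives the event [e <= |Z|] probability at most [s / 2 < s], hence less than [e]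
   under [P]. *)
pose del := s / 2 * e.
have del0 : 0 < del by rewrite mulr_gt0// divr_gt0.
exists [set Z : L0 P | (\int[Q]_w `|Z w|%:E <= del%:E)%E].
split; first exact: convex_solid_L1_ball.
- move=> Z /= ZW; apply: eU.
  have IZ := integrable_norm_le (measurable_L0 Z) ZW.
  have mZ : measurable [set w | e <= `|Z w|].
    by apply: measurable_set_ge; apply: measurableT_comp.
  apply: (@le_lt_trans _ _ (P [set w | e <= `|Z w|])).
    apply: le_measure_ae => //; first exact: measurable_ge_dist.
    have zeroE : {ae P, forall w, (0 : L0 P) w = 0} by exact: L0_classK.
    by apply: filterS zeroE => w zw /=; rewrite zw sub0r normrN.
  apply: sP => //.
  have IZn := integrable_norm_EFin IZ.
  apply: le_lt_trans (markov_Rintegral IZn (fun w => normr_ge0 _) e0) _.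
  rewrite lte_fin ltr_pdivrMr//; apply: (@le_lt_trans _ _ del).
    by rewrite -lee_fin EFin_Rintegral.
  by rewrite /del ltr_pM2r// ltr_pdivrMr// ltr_pMr// ltr1n.
- move=> X AX; have [r r0 rP] := uniformly_integrable_closure_close del0.
  apply/(nbhs_L0_subspace _ AX); exists r => // Y AY XY; split => //.
  by exists (Y - X); [exact: rP|rewrite addrC subrK].
Qed.

End uniform_integrability.
End equivalence.

Theorem corollary3p3 (d : measure_display) (T : measurableType d)
    (R : realType) (P : probability T R) (K : set (L0 P)) :
  nonatomic P -> convex_set K -> bounded_in_L1 K ->
  uniformly_locally_convex_solid (closure K) (closure K) <->
  exists Q : probability T R,
    equivalent_measures Q P /\ uniformly_integrable Q K.
Proof.
move=> _ cK bK; split.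
  exact: uniformly_locally_convex_solid_uniformly_integrable.
by move=> [Q [[QP PQ] UI]];
  exact: uniformly_integrable_locally_convex_solid UI PQ.
Qed.
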